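(* Let $M$ be an acyclic oriented matroid on $[n]=\{1,\dots,n\}$. Then the fine subdivision of the positive Bergman complex $\mathcal{B}^+(M)$ is a geometric realization of $\Delta(\mathcal{F}_{\ell v}(M)-\{\hat 0,\hat 1\})$, the order complex of the proper part of the Las Vergnas face lattice of $M$.
   Context: For $\omega\in\mathbb{R}^n$ and a signed circuit $C$ of $M$, $\operatorname{in}_\omega(C)$ denotes the signed set of elements of $C$ of largest $\omega$-weight among the elements of $C$, with the signs they have in $C$. $M_\omega$ is the oriented matroid on $[n]$ whose signed circuits are the inclusion-minimal members (with respect to supports) of $\{\operatorname{in}_\omega(C): C \text{ a signed circuit of } M\}$ (this is indeed an oriented matroid). An oriented matroid is acyclic if it has no all-positive signed circuit. Let $S^{n-2}=\{\omega\in\mathbb{R}^n : \omega_1+\cdots+\omega_n=0,\ \omega_1^2+\cdots+\omega_n^2=1\}$. The positive Bergman complex of $M$ is $\mathcal{B}^+(M)=\{\omega\in S^{n-2} : M_\omega \text{ is acyclic}\}$. For $\omega\in\mathbb{R}^n$, $\mathcal{F}(\omega)$ is the unique flag of subsets $\emptyset=F_0\subset F_1\subset\dots\subset F_k\subset F_{k+1}=[n]$ (strict inclusions) such that $\omega$ is constant on each $F_i\setminus F_{i-1}$ and $\omega|_{F_i\setminus F_{i-1}}<\omega|_{F_{i+1}\setminus F_i}$. The weight class of a flag $\mathcal{F}$ is the set of $\nu$ with $\mathcal{F}(\nu)=\mathcal{F}$. $M_\omega$ depends only on $\mathcal{F}(\omega)$. The fine subdivision of $\mathcal{B}^+(M)$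 is its subdivision into weight classes: $u,v\in\mathcal{B}^+(M)$ lie in the same cell iff $\mathcal{F}(u)=\mathcal{F}(v)$. A covector $v\in\{+,-,0\}^n$ of $M$ is positive if each entry is $+$ or $0$. A flat of $M$ is positive if it is the $0$-set of a positive covector; additionally $[n]$ is considered a positive flat. The Las Vergnas face lattice $\mathcal{F}_{\ell v}(M)$ is the lattice of positive flats of $M$ ordered by containment; since $M$ is acyclic, $\hat 0=\emptyset$ and $\hat 1=[n]$. The order complex $\Delta(P)$ of a poset $P$ is the simplicial complex of finite chains of $P$. ''Geometric realization'' means: there is a homeomorphism from the geometric realization of the order complex onto $\mathcal{B}^+(M)$ which maps, for each nonempty chain $F_1\subset\dots\subset F_k$, the relatively open simplex of that chain onto the cell $\{\omega\in S^{n-2} : \mathcal{F}(\omega)=(\emptyset\subset F_1\subset\dots\subset F_k\subset[n])\}$, and every cell of the fine subdivision of $\mathcal{B}^+(M)$ arises from exactly one such chain. *)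

(* Defs.v *)
From HB Require Import structures.
From mathcomp Require Import all_boot all_order all_algebra.
From mathcomp Require Import all_classical all_reals all_analysis.

Set Implicit Arguments.
Unset Strict Implicit.
Unset Printing Implicit Defensive.

Import Order.TTheory GRing.Theory Num.Theory.
Import numFieldNormedType.Exports.

Inductive sign := Minus | Zero | Plus.

Definition sign_code (s : sign) : option bool :=
  match s with Minus => Some false | Zero => None | Plus => Some true end.
Definition sign_decode (o : option bool) : sign :=
  match o with Some false => Minus | None => Zero | Some true => Plus end.
Lemma sign_codeK : cancel sign_code sign_decode. Proof. by case. Qed.
HB.instance Definition _ := Equality.copy sign (can_type sign_codeK).
HB.instance Definition _ := Choice.copy sign (can_type sign_codeK).
HB.instance Definition _ := Countable.copy sign (can_type sign_codeK).
HB.instance Definition _ := Finite.copy sign (can_type sign_codeK).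

Definition opp_sign (s : sign) : sign :=
  match s with Minus => Plus | Zero => Zero | Plus => Minus end.

(* A signed subset of [n] is its sign vector in {+,-,0}^n. *)
Notation signed_set n := {ffun 'I_n -> sign}.

Section SignedSets.
Variable n : nat.
Implicit Types X Y : signed_set n.

Definition zero_sv : signed_set n := [ffun=> Zero].
Definition opp_sv X : signed_set n := [ffun i => opp_sign (X i)].
Definition supp X : {set 'I_n} := [set i | X i != Zero]%SET.
Definition pos_part X : {set 'I_n} := [set i | X i == Plus]%SET.
Definition neg_part X : {set 'I_n} := [set i | X i == Minus]%SET.
Definition zero_set X : {set 'I_n} := [set i | X i == Zero]%SET.

Definition positive X : bool := [forall i, X i != Minus].

Definition comp_sv X Y : signed_set n :=
  [ffun i => if X i == Zero then Y i else X i].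

Definition orthogonal X Y : bool :=
  [disjoint supp X & supp Y] ||
  [exists i in supp X :&: supp Y, X i == Y i] &&
  [exists j in supp X :&: supp Y, X j == opp_sign (Y j)].

End SignedSets.

(* The signed circuit axioms; elements are numbered from 0 to n-1. *)
Record oriented_matroid (n : nat) := OrientedMatroid {
  circuits : {set signed_set n};
  circuits_nonempty : zero_sv n \notin circuits;
  circuits_opp : forall X, X \in circuits -> opp_sv X \in circuits;
  circuits_incomparable : forall X Y, X \in circuits -> Y \in circuits ->
    supp X \subset supp Y -> X = Y \/ X = opp_sv Y;
  circuits_elimination : forall X Y (e : 'I_n),
    X \in circuits -> Y \in circuits -> X <> opp_sv Y ->
    e \in pos_part X :&: neg_part Y ->
    exists Z, [/\ Z \in circuits,
      pos_part Z \subset (pos_part X :|: pos_part Y) :\ e &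
      neg_part Z \subset (neg_part X :|: neg_part Y) :\ e] }.

(* Acyclicity of the oriented matroid with set of signed circuits C. *)
Definition acyclic (n : nat) (C : {set signed_set n}) : Prop :=
  forall X, X \in C -> ~~ positive X.

Definition min_supp (n : nat) (A : {set signed_set n}) : {set signed_set n} :=
  [set X in A | [forall Y in A, ~~ (supp Y \proper supp X)]]%SET.

Section Flats.
Variables (n : nat) (M : oriented_matroid n).

(* The signed circuits of the dual oriented matroid. *)
Definition cocircuits : {set signed_set n} :=
  min_supp [set Y : signed_set n |
    (Y != zero_sv n) && [forall X in circuits M, orthogonal X Y]]%SET.

(* Compositions of finitely many cocircuits; the empty composition is 0. *)
Definition covector (v : signed_set n) : Prop :=
  exists2 s : seq (signed_set n),
    all (mem cocircuits) s & v = foldr (@comp_sv n) (zero_sv n) s.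

(* F is closed in the underlying matroid: no circuit has exactly one element
   outside F. *)
Definition flat (F : {set 'I_n}) : bool :=
  [forall X in circuits M, #|supp X :\: F| != 1].

Definition positive_flat (F : {set 'I_n}) : Prop :=
  (flat F /\ exists v, [/\ covector v, positive v & zero_set v = F]) \/
  F = [set: 'I_n]%SET.

(* The underlying set of the lattice; its order is inclusion. *)
Definition las_vergnas_lattice : {set {set 'I_n}} :=
  [set F : {set 'I_n} | `[< positive_flat F >]]%SET.

(* For M acyclic, the bottom is the empty set and the top is [n]. *)
Definition las_vergnas_proper_part : {set {set 'I_n}} :=
  las_vergnas_lattice :\: [set finset.set0; [set: 'I_n]]%SET.

End Flats.

Definition order_complex (T : finType) (le : rel T) (P : {set T}) :
    {set {set T}} :=
  [set c : {set T} | (c \subset P) &&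
    [forall x in c, forall y in c, le x y || le y x]]%SET.

Definition set_le (T : finType) : rel {set T} := fun A B => A \subset B.
Definition set_lt (T : finType) : rel {set T} := fun A B => A \proper B.

Local Open Scope classical_set_scope.
Local Open Scope ring_scope.

Section Realization.
Variables (R : realType) (V : finType).

(* Barycentric coordinates, with the topology of the finite power R^V. *)
Definition realization (K : {set {set V}}) : set {ptws V -> R} :=
  [set x | [/\ forall v, 0 <= x v, \sum_v x v = 1 &
               [set v | x v != 0]%SET \in K]].

Definition open_simplex (s : {set V}) : set {ptws V -> R} :=
  [set x | [/\ forall v, v \in s -> 0 < x v,
               forall v, v \notin s -> x v = 0 & \sum_v x v = 1]].

End Realization.

Definition homeomorphism_on (X Y : topologicalType) (A : set X) (B : set Y)
    (f : X -> Y) : Prop :=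
  [/\ set_bij A B f, {within A, continuous f} &
      exists g : Y -> X,
        {within B, continuous g} /\ forall x, A x -> g (f x) = x].

Section Bergman.
Variables (R : realType) (n : nat).
Implicit Types w u v : 'rV[R]_n.

Definition initial_form w (C : signed_set n) : signed_set n :=
  [ffun i => if [forall j in supp C, w 0 j <= w 0 i] then C i else Zero].

(* The set of signed circuits of M_w. *)
Definition initial_circuits (M : oriented_matroid n) w : {set signed_set n} :=
  min_supp [set initial_form w C | C in circuits M]%SET.

Definition sphere : set 'rV[R]_n :=
  [set w | \sum_i w 0 i = 0 /\ \sum_i (w 0 i) ^+ 2 = 1].

Definition positive_bergman (M : oriented_matroid n) : set 'rV[R]_n :=
  [set w | sphere w /\ acyclic (initial_circuits M w)].

(* The whole flag F_0 = set0, F_1, ..., F_{k+1} = setT is the sequence F. *)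
Definition is_flag (F : seq {set 'I_n}) : bool :=
  [&& ohead F == Some finset.set0, last finset.set0 F == [set: 'I_n]%SET &
      sorted (@set_lt _) F].

(* F_{i+1} minus F_i; it is empty when F_{i+1} is past the end of F. *)
Definition flag_block (F : seq {set 'I_n}) (i : nat) : {set 'I_n} :=
  nth finset.set0 F i.+1 :\: nth finset.set0 F i.

(* F is the flag of w. *)
Definition flag_of w (F : seq {set 'I_n}) : Prop :=
  [/\ is_flag F,
      forall i a b, a \in flag_block F i -> b \in flag_block F i ->
        w 0 a = w 0 b &
      forall i a b, a \in flag_block F i -> b \in flag_block F i.+1 ->
        w 0 a < w 0 b].

Definition same_flag u v : Prop := exists F, flag_of u F /\ flag_of v F.

(* The cells of the fine subdivision are the classes of the relation
   same_flag on the positive Bergman complex. *)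
Definition fine_cell (M : oriented_matroid n) (Z : set 'rV[R]_n) : Prop :=
  exists2 u, positive_bergman M u &
    Z = [set v | positive_bergman M v /\ same_flag u v].

(* s lists F_1, ..., F_k, without the empty set and [n]. *)
Definition weight_cell (s : seq {set 'I_n}) : set 'rV[R]_n :=
  [set w | sphere w /\ flag_of w (finset.set0 :: rcons s [set: 'I_n]%SET)].

End Bergman.

(* A nonempty chain of P, listed in strictly increasing order. *)
Definition nonempty_chain (T : finType) (P : {set {set T}})
    (s : seq {set T}) : Prop :=
  [/\ s != [::], all (mem P) s & sorted (@set_lt _) s].

(* Main.v *)
Require Import Defs.
From HB Require Import structures.
From mathcomp Require Import all_boot all_order all_algebra.
From mathcomp Require Import all_classical all_reals all_analysis.
Import Order.TTheory GRing.Theory Num.Theory.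
Import numFieldNormedType.Exports.

(** A circuit [C] has a positive initial form exactly when it is positive
    off the strict sublevel set of its top weight. Hence [M_w] is acyclic if
    and only if, for each sublevel set [F] of [w], the contraction [M / F]
    is acyclic ([initial_circuits_acyclicP]). By oriented matroid duality,
    [M / F] is acyclic if and only if [F] is the zero set of a positive
    covector ([positive_flatP]). So the positive Bergman complex consists of
    the vectors of the sphere whose flag is a chain of positive flats.

    Duality is obtained from the circuit axioms alone. Contractions are
    oriented matroids because every circuit of [M] decomposes, off the
    contracted set, into conformal circuits of the contraction
    ([contr_cover]). Contracting a hyperplane leaves an oriented matroid in
    which all elements are parallel, where a cocircuit can be written down
    ([hyperplane_cocircuit]); an induction that plays a circuit against a
    cocircuit extends this to Minty's painting lemma ([minty_painting]),
    which produces positive cocircuits.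

    The geometric part does not involve matroids. A vector [w] is
    determined, up to adding a constant, by its gaps: the gap of [F] is the
    amount by which the weights outside [F] exceed those inside, and it is
    positive precisely for the proper nonempty sublevel sets. Conversely
    nonnegative coefficients [x] on a chain of sets define weights [climb x]
    whose gaps are the coefficients. These two operations are mutually
    inverse ([climb_gap], [gap_climb]), and rescaling turns them into
    continuous inverse maps [realize] and [barycentric] between the
    realization of the order complex and the positive Bergman complex. The
    support of a point of the realization is the flag of its image
    ([flag_of_gap_supp]), so open simplices correspond to weight classes. *)

Set Implicit Arguments.
Unset Strict Implicit.
Unset Printing Implicit Defensive.

(** * Sign vectors *)

Section SignVectors.
Variable n : nat.
Implicit Types (X Y Z : signed_set n) (A R : {set 'I_n}).

Lemma opp_signK : involutive opp_sign. Proof. by case. Qed.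

Lemma opp_sign_eq0 s : (opp_sign s == Zero) = (s == Zero).
Proof. by case: s. Qed.

Lemma opp_sign_neq s : s != Zero -> s <> opp_sign s. Proof. by case: s. Qed.

Lemma opp_svE X i : opp_sv X i = opp_sign (X i). Proof. by rewrite ffunE. Qed.

Lemma opp_svK : involutive (@opp_sv n).
Proof. by move=> X; apply/ffunP=> i; rewrite !ffunE opp_signK. Qed.

Lemma sv_neq0 X : X != zero_sv n -> exists i, X i != Zero.
Proof.
move=> X0; apply/existsP; apply: contraR X0 => /existsPn X0.
by apply/eqP/ffunP=> i; rewrite ffunE; apply/eqP; rewrite -[_ == _]negbK X0.
Qed.

Lemma sv_orthP X Y :
  reflect ((forall i, X i != Zero -> Y i = Zero) \/
    (exists i, X i != Zero /\ X i = Y i) /\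
    (exists j, X j != Zero /\ X j = opp_sign (Y j)))
  (Defs.orthogonal X Y).
Proof.
apply: (iffP orP).
  case=> [dXY|/andP[/existsP[i /andP[]] + + /existsP[j /andP[]]]].
    left=> i Xi; apply/eqP; apply: contraTT dXY => Yi.
    by apply/pred0Pn; exists i; rewrite /= !inE Xi Yi.
  rewrite !inE => /andP[Xi _] /eqP XYi /andP[Xj _] /eqP XYj.
  by right; split; [exists i|exists j].
case=> [dXY|[[i [Xi XYi]] [j [Xj XYj]]]]; [left|right].
  apply/pred0P=> i; rewrite /= !inE; apply/negP=> /andP[/dXY->].
  by rewrite eqxx.
apply/andP; split; apply/existsP; [exists i|exists j]; rewrite !inE.
  by rewrite -XYi Xi eqxx.
by rewrite Xj -XYj eqxx -opp_sign_eq0 -XYj Xj.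
Qed.

Definition conformal X Y := forall i, X i != Zero -> X i = Y i.

Definition erase A X : signed_set n :=
  [ffun i => if i \in A then Zero else X i].

Lemma erase_opp A X : erase A (opp_sv X) = opp_sv (erase A X).
Proof. by apply/ffunP=> i; rewrite !ffunE; case: ifP. Qed.

Lemma min_suppP (S : {set signed_set n}) X :
  reflect (X \in S /\ forall Y, Y \in S -> supp Y \subset supp X ->
             supp X \subset supp Y)
          (X \in min_supp S).
Proof.
rewrite inE; apply: (iffP andP) => -[XS H]; split=> //.
  move=> Y YS sYX; have /forallP/(_ Y) := H.
  by rewrite YS properE sYX negbK.
by apply/forallP=> Y; apply/implyP=> YS;
  rewrite properE negb_and negbK -implybE;
  apply/implyP/H.
Qed.

End SignVectors.

(** * Contraction of an oriented matroid *)

Section Circuits.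
Variables (n : nat) (M : oriented_matroid n).
Implicit Types (X Y Z : signed_set n).

Lemma circuit_neq0 X : X \in circuits M -> exists i, X i != Zero.
Proof.
move=> XM; apply: sv_neq0; apply: contraTneq XM => ->.
exact: circuits_nonempty.
Qed.

Lemma circuit_sub X Y : X \in circuits M -> Y \in circuits M ->
  (forall i, X i != Zero -> Y i != Zero) -> X = Y \/ X = opp_sv Y.
Proof.
move=> XM YM sXY; apply: (circuits_incomparable XM YM).
by apply/fintype.subsetP=> i; rewrite !inE; apply: sXY.
Qed.

Lemma circuit_supp X Y i : X \in circuits M -> Y \in circuits M ->
  (forall i, X i != Zero -> Y i != Zero) -> Y i != Zero -> X i != Zero.
Proof.
by move=> XM YM /(circuit_sub XM YM)[->|->] //; rewrite opp_svE opp_sign_eq0.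
Qed.

Lemma circuit_elim X Y e : X \in circuits M -> Y \in circuits M ->
  X <> opp_sv Y -> X e != Zero -> Y e = opp_sign (X e) ->
  exists Z, [/\ Z \in circuits M, Z e = Zero &
                forall i, Z i != Zero -> Z i = X i \/ Z i = Y i].
Proof.
wlog Xe : X Y / X e = Plus => [W XM YM nXY Xe Ye|XM YM nXY _ Ye].
  case Xe': (X e) Xe => // _.
    have YX : Y <> opp_sv X by move=> YX; apply: nXY; rewrite YX opp_svK.
    have Yp : Y e = Plus by rewrite Ye Xe'.
    have [||Z [ZM Ze HZ]] := W Y X Yp YM XM YX; rewrite ?Yp ?Xe' //.
    by exists Z; split=> // i /HZ[]; [right|left].
  by apply: W => //; rewrite Xe'.
have [|Z [ZM Zp Zn]] := @circuits_elimination n M X Y e XM YM nXY.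
  by rewrite !inE Ye Xe.
exists Z; split=> //.
  move: Zp Zn => /fintype.subsetP/(_ e) + /fintype.subsetP/(_ e).
  by rewrite !inE !eqxx /=; case: (Z e) => //= [_ /(_ isT)|/(_ isT)].
move=> i; move: Zp Zn => /fintype.subsetP/(_ i) + /fintype.subsetP/(_ i).
rewrite !inE; case: (Z i) => //= [_ /(_ isT)|/(_ isT) + _];
 by move=> /andP[_ /orP[/eqP->|/eqP->]]; [left|right].
Qed.

Definition contr_circuits (a : 'I_n) : {set signed_set n} :=
  min_supp ([set erase [set a] X | X in circuits M] :\ zero_sv n)%SET.

Lemma contr_circuitsP a Z : Z \in contr_circuits a <->
  [/\ exists2 X, X \in circuits M & Z = erase [set a]%SET X,
      exists i, Z i != Zero &
      forall Y i, Y \in circuits M -> erase [set a]%SET Y i != Zero ->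
        (forall j, erase [set a]%SET Y j != Zero -> Z j != Zero) ->
        forall j, Z j != Zero -> erase [set a]%SET Y j != Zero].
Proof.
split=> [/min_suppP[]|[[X XM ZX] [i Zi] minZ]].
  rewrite in_setD1 => /andP[/sv_neq0 Z0 /imsetP[X XM ZX]] minZ.
  split=> [||Y i YM Yi sYZ j Zj] //; first by exists X.
  have/fintype.subsetP/(_ j) : supp Z \subset supp (erase [set a]%SET Y).
    apply: minZ.
      rewrite in_setD1 imset_f // andbT; apply: contraNneq Yi => ->.
      by rewrite ffunE.
    by apply/fintype.subsetP=> k; rewrite !inE; apply: sYZ.
  by rewrite !inE; apply.
apply/min_suppP; split=> [|Y' /setD1P[/sv_neq0[k Yk] /imsetP[Y YM YE]] sYZ].
  rewrite in_setD1 ZX imset_f // andbT; apply: contraNneq Zi; rewrite ZX => ->.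
  by rewrite ffunE.
apply/fintype.subsetP=> j; rewrite !inE => Zj.
rewrite YE; apply: (minZ Y k) => //; rewrite -YE // => l Yl.
by move/fintype.subsetP/(_ l): sYZ; rewrite !inE; apply.
Qed.

Lemma erase1E (a i : 'I_n) X : erase [set a]%SET X i = if i == a then Zero else
  X i.
Proof. by rewrite ffunE inE. Qed.

(** A circuit through [a] stays minimal after [a] is erased: a smaller
    nonzero erased circuit would come from a circuit with strictly smaller
    support. *)
Lemma contr_circuits_mem a X i : X \in circuits M -> X a != Zero ->
  i != a -> X i != Zero -> erase [set a]%SET X \in contr_circuits a.
Proof.
move=> XM Xa ia Xi; apply/contr_circuitsP; split; first by exists X.
  by exists i; rewrite erase1E (negbTE ia).
move=> Y j YM; rewrite erase1E; case: (j =P a) => // /eqP ja Yj sYX k.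
have sYX' l : Y l != Zero -> X l != Zero.
  have := sYX l; rewrite !erase1E; case: (l =P a) => [-> //|_]; exact.
by rewrite !erase1E; case: (k =P a) => // _; apply: (circuit_supp YM XM sYX').
Qed.

(** Among the circuits supported in [X] and [a] and with the given sign at
    [a], one that disagrees with [X] at the fewest places is conformal to
    [X]: eliminating a place of disagreement with [X] gives a circuit that
    still contains [a], since its support would otherwise lie properly
    inside [X], and that disagrees at fewer places. *)
Lemma conformal_modulo X Y a : X \in circuits M -> X a = Zero ->
    Y \in circuits M -> Y a != Zero ->
    (forall i, i != a -> Y i != Zero -> X i != Zero) ->
  exists Z, [/\ Z \in circuits M, Z a = Y a &
                conformal (erase [set a]%SET Z) X].
Proof.
move=> XM Xa.
have [k] := ubnP #|[set i | (X i != Zero) && (Y i == opp_sign (X i))]%SET|.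
elim: k Y => // k IH Y leY YM Ya sYX.
case: (boolP [exists i, (X i != Zero) && (Y i == opp_sign (X i))]); last first.
  move=> /existsPn noS; exists Y; split=> // i; rewrite erase1E.
  case: (i =P a) => // /eqP ia Yi; have := noS i; rewrite (sYX i) //=.
  by have := sYX i ia Yi; case: (X i) (Y i) Yi => [] [].
case/existsP=> e /andP[Xe /eqP Ye].
have [|W [WM We HW]] := circuit_elim XM YM _ Xe Ye.
  by move/ffunP/(_ a); rewrite Xa opp_svE; case: (Y a) Ya.
have WX i : i != a -> W i != Zero -> X i != Zero.
  by move=> ia Wi; case: (HW i Wi) => [<-//|WY]; apply: sYX => //; rewrite -WY.
have Wa : W a != Zero.
  apply/negP=> /eqP Wa; move: Xe; apply/negP; rewrite negbK -We; apply/eqP.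
  have [i|WX'|WX'] := circuit_sub WM XM.
  - by have := WX i; case: (eqVneq i a) => [->|_ /(_ isT)//]; rewrite Wa.
  - by rewrite WX'.
  - by have := We; rewrite WX' opp_svE; case: (X e).
have WYa : W a = Y a by case: (HW a Wa) => // WXa; move: Wa; rewrite WXa Xa.
have [|Z [ZM Za HZ]] := IH W _ WM Wa WX; last by exists Z; rewrite -WYa.
rewrite -ltnS; apply: leq_trans leY; rewrite ltnS; apply: proper_card.
apply/properP; split; last first.
  by exists e; rewrite !inE Xe ?Ye ?We //; case: (X e) Xe.
apply/fintype.subsetP=> j; rewrite !inE => /andP[Xj /eqP Wj]; rewrite Xj -Wj.
have Wj0 : W j != Zero by rewrite Wj opp_sign_eq0.
case: (HW j Wj0) => [WXj|->]; last by rewrite eqxx.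
by move: Xj Wj; rewrite WXj; case: (X j).
Qed.

(** If erasing [a] from [X] does not give a circuit of the contraction, then
    [conformal_modulo] yields two circuits with opposite signs at [a], both
    conformal to [X] elsewhere. Every [f] in [X] lies in one of them,
    because eliminating [a] between the two gives a circuit inside [X],
    hence with the support of [X]. *)
Lemma contr_cover X a f : X \in circuits M -> f != a -> X f != Zero ->
  exists Z, [/\ Z \in contr_circuits a, Z f = X f & conformal Z X].
Proof.
move=> XM fa Xf.
have confE Y : conformal (erase [set a]%SET Y) Y.
  by move=> i; rewrite erase1E; case: (i =P a).
have [Xa|Xa] := eqVneq (X a) Zero; last first.
  exists (erase [set a]%SET X); split=> //; last by rewrite erase1E (negbTE fa).
  exact: contr_circuits_mem Xf.
have EX : erase [set a]%SET X = X.
  by apply/ffunP=> i; rewrite erase1E; case: (i =P a) => [->|].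
have [XC|XC] := boolP (X \in contr_circuits a); first by exists X; split.
have [Y [i [YM Yi sYX [j Xj Yj]]]] : exists Y i, [/\ Y \in circuits M,
    erase [set a]%SET Y i != Zero,
    forall j, erase [set a]%SET Y j != Zero -> X j != Zero &
    exists2 j, X j != Zero & erase [set a]%SET Y j = Zero].
  apply: contra_notP (negP XC) => H; apply/contr_circuitsP; split.
  - by exists X.
  - by exists f.
  move=> Y i YM Yi sYX j Xj; apply/negP=> /eqP Yj; apply: H.
  by exists Y, i; split=> //; exists j.
have ja : j != a by apply: contraNneq Xj => ->; apply/eqP.
have ia : i != a by apply: contraNneq Yi => ->; rewrite erase1E eqxx.
rewrite !erase1E (negbTE ia) (negbTE ja) in Yi Yj.
have {}sYX k : k != a -> Y k != Zero -> X k != Zero.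
  by move=> ka; have := sYX k; rewrite erase1E (negbTE ka).
have Ya : Y a != Zero.
  apply: contraTneq Xj => Ya; rewrite negbK -Yj; apply/eqP.
  have [k|->|YX] := circuit_sub YM XM.
  - by have := sYX k; case: (eqVneq k a) => [->|_ /(_ isT)//]; rewrite Ya.
  - by [].
  - by move: Yj; rewrite YX opp_svE; case: (X j).
have [Z [ZM Za cZ]] := conformal_modulo XM Xa YM Ya sYX.
have [||Z' [Z'M Z'a cZ']] := conformal_modulo XM Xa (circuits_opp YM).
- by rewrite opp_svE opp_sign_eq0.
- by move=> k ka; rewrite opp_svE opp_sign_eq0; apply: sYX.
have fin W : W \in circuits M -> W a != Zero ->
    conformal (erase [set a]%SET W) X -> W f != Zero ->
  exists Z, [/\ Z \in contr_circuits a, Z f = X f & conformal Z X].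
  move=> WM Wa cW Wf; exists (erase [set a]%SET W); split=> //.
    exact: contr_circuits_mem Wf.
  by apply: cW; rewrite erase1E (negbTE fa).
have [Zf|/(fin Z ZM)] := eqVneq (Z f) Zero; last by rewrite Za; apply.
have [Z'f|/(fin Z' Z'M)] := eqVneq (Z' f) Zero; last first.
  by rewrite Z'a opp_svE opp_sign_eq0; apply.
(* Both are conformal to X off a, so Z = - Z' would have support {a}. *)
have ZY : Z <> opp_sv Z'.
  move=> ZZ.
  have Z0 k : k != a -> Z k = Zero.
    move=> ka; apply/eqP/negPn/negP=> Zk.
    have Z'k : Z' k != Zero by move: Zk; rewrite ZZ opp_svE opp_sign_eq0.
    have := cZ k; have := cZ' k; rewrite !erase1E (negbTE ka).
    move=> /(_ Z'k) <- /(_ Zk).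
    by rewrite ZZ opp_svE => /esym/opp_sign_neq; apply.
  have : Z i != Zero; last by rewrite Z0.
  apply: (circuit_supp ZM YM _ Yi) => k.
  by have [-> _|/Z0->] := eqVneq k a.
have Za0 : Z a != Zero by rewrite Za.
have [|W [WM Wa HW]] := circuit_elim ZM Z'M ZY Za0.
  by rewrite Za Z'a opp_svE.
have WX k : W k != Zero -> X k != Zero.
  have [->|ka] := eqVneq k a; first by rewrite Wa.
  move=> Wk; case: (HW k Wk) => WZ; rewrite WZ in Wk.
    by rewrite -cZ erase1E (negbTE ka).
  by rewrite -cZ' erase1E (negbTE ka).
have Wf := circuit_supp WM XM WX Xf.
by case: (HW f Wf) => WZ; move: Wf; rewrite WZ ?Zf ?Z'f.
Qed.

Lemma contr_circuits_neq0 a : zero_sv n \notin contr_circuits a.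
Proof. by apply/negP=> /contr_circuitsP[_ [i]]; rewrite ffunE. Qed.

Lemma contr_circuits_opp a X : X \in contr_circuits a ->
  opp_sv X \in contr_circuits a.
Proof.
case/contr_circuitsP=> [[Y YM ->] [i Yi] minY]; apply/contr_circuitsP; split.
- by exists (opp_sv Y); [exact: circuits_opp|rewrite erase_opp].
- by exists i; rewrite opp_svE opp_sign_eq0.
move=> Z j ZM Zj sZY k; rewrite opp_svE opp_sign_eq0;
  apply: minY Zj _ _ => // l.
by move/sZY; rewrite opp_svE opp_sign_eq0.
Qed.

Lemma contr_circuits_incomparable a X Y :
  X \in contr_circuits a -> Y \in contr_circuits a ->
  supp X \subset supp Y -> X = Y \/ X = opp_sv Y.
Proof.
case/contr_circuitsP=> [[X' XM ->] [i Xi] _].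
case/contr_circuitsP=> [[Y' YM ->] _ minY] /fintype.subsetP sXY.
have {}sXY k : erase [set a]%SET X' k != Zero -> erase [set a]%SET Y' k != Zero.
  by have := sXY k; rewrite !inE.
have sYX := minY _ _ XM Xi sXY.
suff: X' = Y' \/ X' = opp_sv Y' by rewrite -erase_opp => -[]->; [left|right].
have E k : k != a -> (X' k == Zero) = (Y' k == Zero).
  move=> ka; have := sXY k; have := sYX k; rewrite !erase1E (negbTE ka) => H H'.
  by apply: negb_inj; apply/idP/idP.
have [Xa|Xa] := eqVneq (X' a) Zero.
  apply: (circuit_sub XM YM) => k; have [->|ka] := eqVneq k a;
    first by rewrite Xa.
  by rewrite E.
have [k|->|->] := circuit_sub YM XM; rewrite ?opp_svK; [|by left|by right].
by have [->//|ka] := eqVneq k a; rewrite E.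
Qed.

(** Eliminate in [M] and shrink the result with [contr_cover]: conformality
    keeps the sign conditions. *)
Lemma contr_circuits_elimination a X Y (e : 'I_n) :
  X \in contr_circuits a -> Y \in contr_circuits a -> X <> opp_sv Y ->
  e \in pos_part X :&: neg_part Y ->
  exists Z, [/\ Z \in contr_circuits a,
    pos_part Z \subset (pos_part X :|: pos_part Y) :\ e &
    neg_part Z \subset (neg_part X :|: neg_part Y) :\ e].
Proof.
case/contr_circuitsP=> [[X' XM ->] [i Xi] _].
case/contr_circuitsP=> [[Y' YM ->] [j Yj] _] nXY.
rewrite !inE !erase1E; have [//|ea] := eqVneq e a => /andP[/eqP Xe /eqP Ye].
have [|||U [UM Ue HU]] := @circuit_elim X' Y' e XM YM.
- by move=> XY; apply: nXY; rewrite XY erase_opp.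
- by rewrite Xe.
- by rewrite Xe Ye.
(* U is not the loop at a, since X' and Y' are nonzero off a. *)
have [f fa Uf] : exists2 f, f != a & U f != Zero.
  have [f Uf] := circuit_neq0 UM; have [fa|] := eqVneq f a; last by exists f.
  rewrite {}fa {f} in Uf.
  have [//|noU] := pselect (exists2 f, f != a & U f != Zero).
  have U0 k : U k != Zero -> k = a.
    move=> Uk; apply/eqP/negPn/negP => ka; apply: noU; by exists k.
  case: (HU a Uf) => UE; rewrite UE in Uf.
    have : U e != Zero; last by rewrite Ue.
    by apply: (circuit_supp UM XM); rewrite ?Xe // => k /U0->.
  have : U e != Zero; last by rewrite Ue.
  by apply: (circuit_supp UM YM); rewrite ?Ye // => k /U0->.
have [Z [ZN Zf cZ]] := contr_cover UM fa Uf.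
have Za : Z a = Zero by have /contr_circuitsP[[V _ ->] _ _] := ZN;
  rewrite erase1E eqxx.
have HZ k : Z k != Zero -> k != e /\
    (Z k = erase [set a]%SET X' k \/ Z k = erase [set a]%SET Y' k).
  move=> Zk; have ka : k != a by apply: contraNneq Zk => ->; rewrite Za.
  split; first by apply: contraNneq (Zk) => ke; rewrite cZ // ke Ue.
  rewrite !erase1E (negbTE ka) cZ //; apply: HU; rewrite -cZ //.
exists Z; split=> //; apply/fintype.subsetP=> k; rewrite !inE => /eqP Zk;
  (have [|-> H] := HZ k; first by rewrite Zk);
  by rewrite Zk in H; case: H => <-; rewrite ?orbT.
Qed.

Definition contraction (a : 'I_n) : oriented_matroid n :=
  OrientedMatroid (contr_circuits_neq0 a) (@contr_circuits_opp a)
    (@contr_circuits_incomparable a) (@contr_circuits_elimination a).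

End Circuits.

(** Contracting the elements of [A] one after the other: circuits of the
    result lift to [M], and circuits of [M] decompose conformally off [A].
    These two properties are all that is used of a contraction. *)
Lemma contraction_exists n (M : oriented_matroid n) (A : {set 'I_n}) :
  exists N : oriented_matroid n,
    (forall Z, Z \in circuits N ->
      exists2 X, X \in circuits M & Z = erase A X) /\
    (forall X f, X \in circuits M -> f \notin A -> X f != Zero ->
      exists Z, [/\ Z \in circuits N, Z f = X f & conformal Z X]).
Proof.
have -> : A = [set:: enum A]%SET by apply/setP=> i; rewrite inE mem_enum.
elim: (enum A) => [|a r [N [NM cN]]].
  exists M; split=> [Z ZM|X f XM _ Xf]; last by exists X; split.
  by exists Z => //; apply/ffunP=> i; rewrite ffunE inE.
exists (contraction N a).
split=> [Z /contr_circuitsP[[Y /NM[X XM ->] ->] _ _]|].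
  by exists X => //; apply/ffunP=> i; rewrite !ffunE !inE; case: (i =P a);
    case: (i \in r).
move=> X f XM; rewrite !inE negb_or => /andP[fa fr] Xf.
have [|Y [YN Yf cY]] := cN X f XM _ Xf; first by rewrite inE.
have [|Z [ZN Zf cZ]] := @contr_cover n N Y a f YN fa; first by rewrite Yf.
exists Z; split=> //; first by rewrite Zf.
by move=> i Zi; rewrite cZ // cY // -cZ.
Qed.

(** * Contractions of rank one *)

Section RankOne.
Variables (n : nat) (N : oriented_matroid n) (A : {set 'I_n}) (e : 'I_n).
Hypothesis zeroA : forall Z i, Z \in circuits N -> i \in A -> Z i = Zero.
Hypothesis loopless : forall Z, Z \in circuits N -> Z e != Zero ->
  exists2 i, i != e & Z i != Zero.
Hypothesis parallel : forall g, g \notin A -> g != e ->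
  exists Z, [/\ Z \in circuits N, Z e != Zero &
                forall i, Z i != Zero -> i = e \/ i = g].

(** When all elements off [A] are parallel to [e], the signs of the only
    cocircuit are forced: orthogonality to the two-element circuit through
    [e] and [i] requires opposite products of signs at [e] and [i]. *)
Definition parallel_cocircuit : signed_set n :=
  [ffun i => if i == e then Plus else if i \in A then Zero else
   if [exists Z in circuits N, [&& Z e == Plus, Z i == Minus &
        [forall j, (Z j != Zero) ==> ((j == e) || (j == i))]]]
   then Plus else Minus].

Lemma parallel_pair g : g \notin A -> g != e ->
  exists Z, [/\ Z \in circuits N, Z e = Plus,
    Z g = opp_sign (parallel_cocircuit g) &
                forall i, Z i != Zero -> i = e \/ i = g].
Proof.
move=> gA ge; rewrite ffunE (negbTE ge) (negbTE gA).
case: ifPn.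
  case/existsP=> Z /and4P[ZN /eqP Ze /eqP Zg /forallP HZ].
  exists Z; split=> // i Zi.
  by have := HZ i; rewrite Zi /= => /orP[] /eqP; [left|right].
move/existsPn=> noZ.
have [Z [ZN Ze HZ]] := parallel gA ge.
wlog Zp : Z ZN Ze HZ / Z e = Plus => [W|].
  case E: (Z e) Ze => // _; last by apply: (W Z); rewrite // E.
  apply: (W (opp_sv Z)); rewrite ?circuits_opp ?opp_svE ?E //.
  by move=> i; rewrite opp_svE opp_sign_eq0; apply: HZ.
exists Z; split=> //; have [i ie Zi] := loopless ZN Ze.
case: (HZ i Zi) => [ie'|ig]; first by rewrite ie' eqxx in ie.
rewrite ig in Zi; case E: (Z g) Zi => // _.
have := noZ Z; rewrite ZN Zp E /= => /negP[]; apply/forallP=> j.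
by apply/implyP=> /HZ[]->; rewrite eqxx ?orbT.
Qed.

Lemma parallel_cocircuit_out i : i \notin A -> parallel_cocircuit i != Zero.
Proof. by rewrite ffunE => /negbTE->; case: ifP => // _; case: ifP. Qed.

Lemma parallel_pair_signs g V : V \in circuits N -> g \notin A -> g != e ->
  V e != Zero -> V g != Zero ->
  (exists i, V i != Zero /\ V i = parallel_cocircuit i) /\
  (exists i, V i != Zero /\ V i = opp_sign (parallel_cocircuit i)).
Proof.
move=> VN gA ge Ve Vg.
have [Z [ZN Ze Zg HZ]] := parallel_pair gA ge.
have De : parallel_cocircuit e = Plus by rewrite ffunE eqxx.
have [i /HZ[]->//|ZV|ZV] := circuit_sub ZN VN.
  split; first by exists e; rewrite -ZV De Ze.
  by exists g; rewrite -ZV Zg opp_sign_eq0 parallel_cocircuit_out.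
have VZ : V = opp_sv Z by rewrite ZV opp_svK.
split; [exists g|exists e]; rewrite VZ !opp_svE ?De ?Ze // Zg opp_signK.
by rewrite parallel_cocircuit_out.
Qed.

(** A circuit through [e] contains the support of a two-element circuit
    through [e], hence equals it up to sign. A circuit that misses [e]
    contains two elements [g], [h] off [A]; eliminating [e] between the
    circuits on [e], [g] and on [e], [h] gives one on [g], [h], which the
    circuit equals up to sign. *)
Lemma parallel_cocircuit_orth V : V \in circuits N ->
  (exists i, V i != Zero /\ V i = parallel_cocircuit i) /\
  (exists i, V i != Zero /\ V i = opp_sign (parallel_cocircuit i)).
Proof.
move=> VN; have VA i : V i != Zero -> i \notin A.
  by apply: contraNN => iA; rewrite zeroA.
have [Ve|Ve] := eqVneq (V e) Zero; last first.
  by have [g ge Vg] := loopless VN Ve;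
    apply: (parallel_pair_signs VN (VA g Vg)).
have ne i : V i != Zero -> i != e by apply: contraNneq => ->; rewrite Ve.
have [g Vg] := circuit_neq0 VN.
have [Z [ZN Ze Zg HZ]] := parallel_pair (VA g Vg) (ne g Vg).
have [h hg Vh] : exists2 h, h != g & V h != Zero.
  have [//|noh] := pselect (exists2 h, h != g & V h != Zero).
  have : V e != Zero; last by rewrite Ve.
  apply: (circuit_supp VN ZN); last by rewrite Ze.
  move=> i Vi; have [->|ig] := eqVneq i g; last by case: noh; exists i.
  by rewrite Zg opp_sign_eq0 parallel_cocircuit_out // VA.
have [Y [YN Ye Yh HY]] := parallel_pair (VA h Vh) (ne h Vh).
have Yg : Y g = Zero.
  apply/eqP/negPn/negP => /HY[ge|gh]; first by have := ne g Vg; rewrite ge eqxx.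
  by rewrite gh eqxx in hg.
have Zh : Z h = Zero.
  apply/eqP/negPn/negP => /HZ[he|gh]; first by have := ne h Vh; rewrite he eqxx.
  by rewrite gh eqxx in hg.
have [|||W [WN We HW]] := @circuit_elim _ N Z (opp_sv Y) e ZN (circuits_opp YN).
- rewrite opp_svK => /ffunP/(_ g); rewrite Yg Zg => /eqP.
  by rewrite opp_sign_eq0 (negbTE (parallel_cocircuit_out (VA g Vg))).
- by rewrite Ze.
- by rewrite opp_svE Ye Ze.
have WV i : W i != Zero -> V i != Zero.
  have [->|ie] := eqVneq i e; first by rewrite We.
  move=> Wi; case: (HW i Wi) => E; move: Wi; rewrite E ?opp_svE ?opp_sign_eq0.
    by move=> /HZ[ie'|->//]; rewrite ie' eqxx in ie.
  by move=> /HY[ie'|->//]; rewrite ie' eqxx in ie.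
have Wgh i : V i != Zero -> W i != Zero by exact: (circuit_supp WN VN WV).
have Wg : W g = opp_sign (parallel_cocircuit g).
  case: (HW g (Wgh g Vg)) => E; first by rewrite E Zg.
  by have := Wgh g Vg; rewrite E opp_svE Yg.
have Wh : W h = parallel_cocircuit h.
  case: (HW h (Wgh h Vh)) => E; last by rewrite E opp_svE Yh opp_signK.
  by have := Wgh h Vh; rewrite E Zh.
have [//|VW|VW] := circuit_sub VN WN.
- by split; [exists h|exists g]; rewrite VW ?Wgh.
- split; [exists g|exists h]; rewrite VW !opp_svE opp_sign_eq0 Wgh //;
  split=> //.
    by rewrite Wg opp_signK.
  by rewrite Wh.
Qed.
End RankOne.

(** * Painting and positive flats *)

Section Painting.
Variables (n : nat) (M : oriented_matroid n).
Implicit Types (X Y Z : signed_set n) (B R F : {set 'I_n}).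

Lemma cocircuit_orth D X : D \in cocircuits M -> X \in circuits M ->
  Defs.orthogonal X D.
Proof.
by case/min_suppP; rewrite inE => /andP[_ /forallP H] _ XM; have := H X;
  rewrite XM.
Qed.

(** Enlarge [R] to a maximal set [A] such that no circuit through [e] lies
    in [e |: A]; in matroid terms [A] is a hyperplane avoiding [e]. After
    contracting [A] every other element is parallel to [e], so the signs of
    [parallel_cocircuit] define the required cocircuit. Its support is
    minimal because a vector that vanishes on [A] and is orthogonal to a
    circuit on [e], [g] and [A] vanishes either at both [e] and [g] or at
    none of them. *)
Lemma hyperplane_cocircuit R e : e \notin R ->
  (forall X, X \in circuits M -> X e != Zero ->
    exists2 i, X i != Zero & i \notin e |: R) ->
  exists D, [/\ D \in cocircuits M, D e = Plus &
                forall i, i \in R -> D i = Zero].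
Proof.
move=> eR no_X.
pose good (S : {set 'I_n}) := (e \notin S) &&
  [forall X in circuits M, (X e != Zero) ==>
  [exists i, (X i != Zero) && (i \notin e |: S)]].
have goodR : good R.
  rewrite /good eR; apply/forall_inP=> X XM; apply/implyP=> Xe.
  by have [i Xi iR] := no_X X XM Xe; apply/existsP; exists i; rewrite Xi.
have [A maxA sRA] := maxset_exists goodR.
have [/andP[eA /forall_inP Ae] {}maxA] := maxsetP maxA.
have [N [NM cN]] := contraction_exists M A.
have zeroA Z i : Z \in circuits N -> i \in A -> Z i = Zero.
  by move=> /NM[X _ ->] iA; rewrite ffunE iA.
have loopless Z : Z \in circuits N -> Z e != Zero ->
    exists2 i, i != e & Z i != Zero.
  move=> /NM[X XM ->]; rewrite ffunE (negbTE eA) => Xe.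
  have /implyP/(_ Xe)/existsP[i] := Ae X XM.
  rewrite !inE negb_or => /and3P[Xi ie iA].
  by exists i; rewrite ?ffunE ?(negbTE iA).
have parallel g : g \notin A -> g != e ->
    exists Z, [/\ Z \in circuits N, Z e != Zero &
                forall i, Z i != Zero -> i = e \/ i = g].
  move=> gA ge.
  have [X [XM Xe HX]] : exists X, [/\ X \in circuits M, X e != Zero &
      forall i, X i != Zero -> i \in e |: (g |: A)].
    apply: contra_notP (negP gA) => H.
    suff /maxA <- : good (g |: A) by rewrite ?finset.subsetUr // !inE eqxx.
    rewrite /good !inE negb_or eq_sym ge eA; apply/forall_inP=> X XM.
    apply/implyP=> Xe; apply/existsP; apply: contra_notP H => H.
    exists X; split=> // i Xi; apply/negPn/negP => iA; apply: H.
    by exists i; rewrite Xi.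
  have [Z [ZN Ze cZ]] := cN X e XM eA Xe.
  exists Z; split=> //; first by rewrite Ze.
  move=> i Zi; have := HX i; rewrite -cZ // => /(_ Zi); rewrite !inE.
  case/or3P=> [/eqP|/eqP|iA]; [by left|by right|].
  by rewrite zeroA in Zi.
pose D := parallel_cocircuit N A e.
have De : D e = Plus by rewrite ffunE eqxx.
have DA i : i \in A -> D i = Zero.
  by move=> iA; rewrite ffunE iA; case: eqP => // ie; rewrite -ie iA in eA.
have DA' i : D i != Zero -> i \notin A by apply: contraNN => /DA->.
exists D; split=> //; last by move=> i /(fintype.subsetP sRA); apply: DA.
apply/min_suppP; split=> [|Y].
  rewrite inE; apply/andP; split.
    by apply/negP=> /eqP/ffunP/(_ e); rewrite De ffunE.
  apply/forall_inP=> X XM; apply/sv_orthP.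
  have [dXA|/existsNP[i /not_implyP[Xi /eqP/DA' iA]]] :=
    pselect (forall i, X i != Zero -> D i = Zero); first by left.
  right.
  have [Z [ZN Zi cZ]] := cN X i XM iA Xi.
  have [[j [Zj Hj]] [k [Zk Hk]]] :=
    parallel_cocircuit_orth zeroA loopless parallel ZN.
  by split; [exists j|exists k]; rewrite -cZ.
rewrite inE => /andP[/sv_neq0[k Yk] /forall_inP YM] /fintype.subsetP sYD.
have YA i : i \in A -> Y i = Zero.
  move=> iA; have := sYD i; rewrite !inE DA // => H.
  by apply/eqP/negPn/negP=> /H.
have YA' i : Y i != Zero -> i \notin A by apply: contraNN => /YA->.
have Ye g : g \notin A -> g != e -> (Y g == Zero) = (Y e == Zero).
  move=> gA ge; have [Z [/NM[X XM ZX] Ze Zg HZ]] :=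
    parallel_pair loopless parallel gA ge.
  have {Ze}Xe : X e != Zero.
    by move: Ze; rewrite ZX ffunE (negbTE eA) => ->.
  have {Zg}Xg : X g != Zero.
    have -> : X g = Z g by rewrite ZX ffunE (negbTE gA).
    by rewrite Zg opp_sign_eq0 parallel_cocircuit_out.
  have {}HZ i : X i != Zero -> Y i != Zero -> i = e \/ i = g.
    have [iA|iA] := boolP (i \in A); first by rewrite YA.
    by move=> Xi _; apply: HZ; rewrite ZX ffunE (negbTE iA).
  have /sv_orthP[H|[[i [Xi Hi]] [j [Xj Hj]]]] := YM X XM.
    by rewrite !H ?eqxx.
  have Yi : Y i != Zero by rewrite -Hi.
  have Yj : Y j != Zero by rewrite -opp_sign_eq0 -Hj.
  have ij : i <> j by move=> ij; move: Hj; rewrite -ij Hi; apply: opp_sign_neq.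
  have Hi' := HZ i Xi Yi; have Hj' := HZ j Xj Yj.
  case: Hi' Hj' Yi Yj ij => [->|->] [->|->] // + + _;
    by do 2!move=> /negbTE->.
have Ye0 : Y e != Zero.
  have [<-//|ke] := eqVneq k e.
  by rewrite -(Ye k) // YA'.
apply/fintype.subsetP=> i; rewrite !inE => Di.
have [->//|ie] := eqVneq i e.
by rewrite Ye // DA'.
Qed.

(** Minty's painting lemma. If [B] has an element [f] other than [e], drop
    the sign condition at [f] in two ways: for the circuit, while forbidding
    [f] in the cocircuit, or the other way round. Unless one of these solves
    the problem, the first gives a circuit and the second a cocircuit, both
    negative at [f]. They agree at [e] and at [f] and never have opposite
    signs, which contradicts orthogonality. When [B] is reduced to [e], this
    is [hyperplane_cocircuit]. *)
Lemma minty_painting B R e : e \in B -> [disjoint B & R] ->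
  (exists X, [/\ X \in circuits M, X e = Plus,
                 forall i, i \in B -> X i != Minus &
                 forall i, X i != Zero -> i \in B :|: R]) \/
  (exists D, [/\ D \in cocircuits M, D e = Plus,
                 forall i, i \in B -> D i != Minus &
                 forall i, i \in R -> D i = Zero]).
Proof.
have [k] := ubnP #|B|.
elim: k B R => // k IH B R leBk eB dBR.
have eR : e \notin R by rewrite (disjointFr dBR).
have [[f fe fB]|noB] := pselect (exists2 f, f != e & f \in B); last first.
  have Be i : i \in B -> i = e.
    by move=> iB; apply/eqP/negPn/negP=> ie; apply: noB; exists i.
  have [[X [XM Xe HX]]|no_X] := pselect (exists X, [/\ X \in circuits M,
      X e != Zero & forall i, X i != Zero -> i \in e |: R]).
    left; wlog Xp : X XM Xe HX / X e = Plus => [W|].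
      case E: (X e) Xe => // _; last by apply: (W X); rewrite // E.
      apply: (W (opp_sv X)); rewrite ?circuits_opp ?opp_svE ?E //.
      by move=> i; rewrite opp_svE opp_sign_eq0; apply: HX.
    exists X; split=> // [i /Be->|i /HX]; first by rewrite Xp.
    by rewrite !inE => /orP[/eqP->|->]; rewrite ?eB ?orbT.
  right; have [|D [DM De DR]] := hyperplane_cocircuit eR.
    move=> X XM Xe; apply: contra_notP no_X => noi; exists X; split=> // i Xi.
    by apply/negPn/negP=> iR; apply: noi; exists i.
  by exists D; split=> // i /Be->; rewrite De.
have fR : f \notin R by rewrite (disjointFr dBR).
have leB : #|B :\ f| < k by rewrite (cardsD1 f) fB in leBk.
have eBf : e \in B :\ f by rewrite !inE eq_sym fe.
have BfB i : i \in B :\ f -> i \in B by rewrite !inE => /andP[].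
(* With f in neither set it is forbidden in the circuit and unrestricted in
   the cocircuit; with f in R it is the other way round. *)
have dBfR : [disjoint B :\ f & R].
  apply/pred0P=> i /=; apply/negP=> /andP[/BfB iB].
  by rewrite (disjointFr dBR iB).
have dBf : [disjoint B :\ f & f |: R].
  apply/pred0P=> i /=; rewrite !inE; apply/negP=> /andP[/andP[/negbTE-> iB]].
  by rewrite (disjointFr dBR iB).
have [[X [XM Xe XB XR]]|[D [DM De DB DR]]] :=
  IH (B :\ f) (f |: R) leB eBf dBf; last first.
  right; exists D; split=> // i iR; last by rewrite DR // !inE iR orbT.
  have [->|fi] := eqVneq i f; first by rewrite DR ?inE ?eqxx.
  by rewrite DB // !inE fi.
have [[Y [YM Ye YB YR]]|[D [DM De DB DR]]] := IH (B :\ f) R leB eBf dBfR.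
  left; exists Y; split=> // i.
    have [->|fi] := eqVneq i f => iB; last by rewrite YB // !inE fi.
    apply/negP=> /eqP Yf; have := YR f; rewrite Yf => /(_ isT).
    by rewrite !inE eqxx (negbTE fR).
  by move/YR; rewrite !inE => /orP[/andP[_ ->]|->]; rewrite ?orbT.
have [Xf|Xf] := eqVneq (X f) Minus; last first.
  left; exists X; split=> // i.
    by have [->//|fi iB] := eqVneq i f; rewrite XB // !inE fi.
  by move/XR; rewrite !inE => /orP[/andP[_ ->]//|/orP[/eqP->|->]];
    rewrite ?fB ?orbT.
have [Df|Df] := eqVneq (D f) Minus; last first.
  right; exists D; split=> // i.
  by have [->//|fi iB] := eqVneq i f; rewrite DB // !inE fi.
exfalso.
have /sv_orthP[/(_ e)|[_ [j [Xj Hj]]]] := cocircuit_orth DM XM.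
  by rewrite Xe De => /(_ isT).
have Dj : D j != Zero by rewrite -opp_sign_eq0 -Hj.
have [jf|jf] := eqVneq j f; first by move: Hj; rewrite jf Xf Df.
have := XR j Xj; rewrite !inE (negbTE jf) /= => /orP[jB|jR]; last first.
  by rewrite DR in Dj.
have jBf : j \in B :\ f by rewrite !inE jf.
by move: (XB j jBf) (DB j jBf) Xj Dj Hj; case: (X j) (D j) => [] [].
Qed.

(** Orthogonality passes to compositions: where the first cocircuit meets
    the circuit it decides alone, and elsewhere the remaining composition
    does. *)
Lemma covector_orth v X : covector M v -> X \in circuits M ->
  Defs.orthogonal X v.
Proof.
case=> s sM -> XM; elim: s sM => [_|D s IH /=/andP[DM /IH{}IH]].
  by apply/sv_orthP; left=> i _; rewrite ffunE.
have /sv_orthP[H|[[i [Xi Hi]] [j [Xj Hj]]]] := cocircuit_orth DM XM.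
  have /sv_orthP[H'|[[i [Xi Hi]] [j [Xj Hj]]]] := IH; apply/sv_orthP.
    by left=> i Xi; rewrite ffunE H // H'.
  by right; split; [exists i|exists j]; rewrite ffunE H.
apply/sv_orthP; right; split; [exists i|exists j]; rewrite ffunE.
  by rewrite ifN // -Hi.
by rewrite ifN // -opp_sign_eq0 -Hj.
Qed.

(** Acyclicity of the contraction of [M] by [F], expressed with circuits of
    [M]. *)
Definition contraction_acyclic F := forall X, X \in circuits M ->
  (exists2 i, i \notin F & X i != Zero) -> exists2 i, i \notin F & X i = Minus.

(** A positive covector vanishing exactly on [F] is orthogonal to every
    circuit, so no circuit is nonzero and nonnegative off [F]. Conversely
    [minty_painting] with [B] the complement of [F] gives, for each [e] off
    [F], a positive cocircuit that vanishes on [F] and contains [e];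
    composing all of these gives the covector. *)
Lemma positive_flatP F : positive_flat M F <-> contraction_acyclic F.
Proof.
split.
  case=> [[_ [v [vM v0 vF]]]|->] X XM [i iF Xi]; last by rewrite inE in iF.
  have Fv j : (j \in F) = (v j == Zero) by rewrite -vF inE.
  have /sv_orthP[H|[_ [j [Xj Hj]]]] := covector_orth vM XM.
    by move: iF; rewrite Fv H ?eqxx.
  have vj : v j != Zero by rewrite -opp_sign_eq0 -Hj.
  exists j; first by rewrite Fv.
  by have /forallP/(_ j) := v0; rewrite Hj; case: (v j) vj.
move=> F0; have [->|FT] := eqVneq F [set: 'I_n]%SET; [by right|left].
split.
  apply/forall_inP=> X XM; apply/negP=> /cards1P[i Hi].
  have iF : i \notin F /\ X i != Zero.
    by have := finset.set11 i; rewrite -Hi !inE => /andP[].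
  have Xi j : j \notin F -> X j != Zero -> j = i.
    by move=> jF Xj; apply/eqP; rewrite -finset.in_set1 -Hi !inE jF.
  have [|j jF Xj] := F0 X XM; first by exists i; case: iF.
  have ? : j = i by apply: Xi; rewrite ?Xj. subst j.
  (* A single element off F would be positive in X or in its opposite. *)
  have [|j j'F] := F0 (opp_sv X) (circuits_opp XM).
    by exists i; rewrite ?opp_svE ?Xj.
  rewrite opp_svE => Xj'.
  have ? : j = i by apply: Xi => //; case: (X j) Xj'. subst j.
  by rewrite Xj in Xj'.
pose s := enum
  [set D in cocircuits M | positive D && (F \subset zero_set D)]%SET.
have sP D :
    D \in s = [&& D \in cocircuits M, positive D & F \subset zero_set D].
  by rewrite mem_enum inE.
exists (foldr (@comp_sv n) (zero_sv n) s).
have v0 i (t : seq (signed_set n)) :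
    (foldr (@comp_sv n) (zero_sv n) t i == Zero)
      = all (fun D : signed_set n => D i == Zero) t.
  by elim: t => [|D t IH] /=; rewrite ffunE ?eqxx //; case: ifP => // ->.
split.
- by exists s => //; apply/allP=> D; rewrite sP => /and3P[].
- have : all (@positive n) s by apply/allP=> D; rewrite sP => /and3P[].
  elim: s {sP} => [_|D t IH /= /andP[/forallP D0 /IH/forallP tP]];
    apply/forallP=> i; rewrite ffunE //.
  by case: ifP.
apply/setP=> i; rewrite inE v0; apply/allP/idP=> [H|iF D].
  apply/negPn/negP=> iF.
  have [||[X [XM Xi X0 _]]|[D [DM Di D0 DF]]] := @minty_painting (~: F) F i.
  - by rewrite inE.
  - by rewrite finset.disjoints_subset.
  - have [|j jF Xj] := F0 X XM; first by exists i; rewrite ?Xi.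
    by have := X0 j; rewrite inE jF Xj => /(_ isT).
  suff /H : D \in s by rewrite Di.
  rewrite sP DM /=; apply/andP; split.
    apply/forallP=> j; have [jF|jF] := boolP (j \in F); first by rewrite DF.
    by rewrite D0 // inE.
  by apply/fintype.subsetP=> j jF; rewrite inE DF.
by rewrite sP => /and3P[_ _ /fintype.subsetP/(_ i iF)]; rewrite inE.
Qed.

End Painting.

Local Open Scope ring_scope.

(** * Acyclicity of the initial oriented matroid *)

Section InitialForms.
Variables (R : realType) (n : nat) (M : oriented_matroid n).
Implicit Types (X Y Z C : signed_set n) (w : 'rV[R]_n).

Definition sublevel w (a : 'I_n) : {set 'I_n} := [set i | w 0 i <= w 0 a]%SET.

Lemma supp_max w X : (exists i, X i != Zero) ->
  exists2 m, X m != Zero & forall i, X i != Zero -> w 0 i <= w 0 m.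
Proof.
move=> [i0 Xi0].
case: (@Order.TotalTheory.arg_maxP _ _ _ i0 (fun i => X i != Zero) (w 0) Xi0).
by move=> m Xm Hm; exists m.
Qed.

(** One maximal element [m] of the support determines the whole initial
    form. *)
Lemma initial_formE w X m i :
    X m != Zero -> (forall j, X j != Zero -> w 0 j <= w 0 m) ->
  initial_form w X i = if w 0 m <= w 0 i then X i else Zero.
Proof.
move=> Xm Hm; rewrite ffunE; congr (if _ then _ else _).
apply/forall_inP/idP => [|mi j]; first by apply; rewrite inE.
by rewrite inE => /Hm/le_trans; apply.
Qed.

Lemma strict_sublevel_contraction_acyclic w m : acyclic (circuits M) ->
  (forall a, contraction_acyclic M (sublevel w a)) ->
  contraction_acyclic M [set i | w 0 i < w 0 m]%SET.
Proof.
move=> Mac H.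
(* The strict sublevel set is empty or the sublevel set of its top element. *)
have [[a am]|noa] := pselect (exists a, w 0 a < w 0 m); last first.
  move=> X XM _; have /forallPn[i] := Mac X XM.
  rewrite negbK => /eqP Xi; exists i => //; rewrite inE.
  by apply/negP=> im; apply: noa; exists i.
case: (@Order.TotalTheory.arg_maxP _ _ _ a (fun i => w 0 i < w 0 m) (w 0) am)
  => b bm Hb.
have -> : [set i | w 0 i < w 0 m]%SET = sublevel w b; last exact: H.
apply/setP=> i; rewrite !inE; apply/idP/idP => [/Hb//|ib].
exact: le_lt_trans bm.
Qed.

(** An initial form is the part of a circuit off the strict sublevel set of
    its top weight, so a positive one is a circuit that is nonnegative off
    this set, in conflict with the contraction by the sublevel set being
    acyclic. For the converse, suppose that [C] is nonnegative and nonzero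
    off a sublevel set. Contract the strict sublevel set [G] of its top
    weight: a circuit of the contraction that is conformal to [C] is
    positive, is an initial form, and has minimal support among the initial
    forms, because these again decompose into circuits of the contraction by
    [G]. *)
Lemma initial_circuits_acyclicP w : acyclic (circuits M) ->
  acyclic (initial_circuits M w) <-> forall a, positive_flat M (sublevel w a).
Proof.
move=> Mac; split=> [wac a|wac].
  apply/positive_flatP => C CM [i iF Ci].
  have [//|noC] := pselect (exists2 j, j \notin sublevel w a & C j = Minus).
  exfalso.
  have [m Cm Hm] := supp_max w (ex_intro _ i Ci).
  have am : w 0 a < w 0 m.
    by rewrite inE -ltNge in iF; apply: lt_le_trans iF (Hm i Ci).
  have [N [NM cN]] := contraction_exists M [set i | w 0 i < w 0 m]%SET.
  have [|Z [ZN Zm cZ]] := cN C m CM _ Cm; first by rewrite inE ltxx.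
  have Zout V j : V \in circuits N -> V j != Zero -> w 0 m <= w 0 j.
    by move=> /NM[X _ ->]; rewrite ffunE inE; case: ltP.
  have Zw j : Z j != Zero -> w 0 j = w 0 m.
    move=> Zj; apply/eqP; rewrite eq_le (Zout Z) // andbT.
    by apply: Hm; rewrite -cZ.
  have [X XM ZX] := NM Z ZN.
  have Zm0 : Z m != Zero by rewrite Zm.
  have Xm : X m != Zero by move: Zm0; rewrite ZX ffunE inE ltxx.
  have Xw j : X j != Zero -> w 0 j <= w 0 m.
    move=> Xj; rewrite leNgt; apply/negP=> mj; move: (mj).
    by rewrite (Zw j) ?ltxx // ZX ffunE inE ltNge (ltW mj).
  (* The top weight of X is that of m, so its initial form discards exactly
     the contracted set. *)
  have XZ : initial_form w X = Z.
    apply/ffunP=> j; rewrite (initial_formE _ Xm Xw) ZX ffunE inE.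
    by case: ltP.
  have : Z \in initial_circuits M w.
    apply/min_suppP; split; first by rewrite -XZ imset_f.
    move=> _ /imsetP[Y YM ->] /fintype.subsetP sYZ; apply/fintype.subsetP=> j.
    have [y Yy Hy] := supp_max w (circuit_neq0 YM).
    have yE i' := initial_formE i' Yy Hy.
    have sYZ' i' : initial_form w Y i' != Zero -> Z i' != Zero.
      by have := sYZ i'; rewrite !inE.
    have yw : w 0 y = w 0 m by apply/Zw/sYZ'; rewrite yE lexx.
    have [|Z' [Z'N Z'y cZ']] := cN Y y YM _ Yy; first by rewrite inE yw ltxx.
    have Z'Y k : Z' k != Zero -> initial_form w Y k != Zero.
      by move=> Z'k; rewrite yE yw (Zout Z') // -cZ'.
    rewrite !inE => Zj; apply/Z'Y; apply: (circuit_supp Z'N ZN) Zj => k.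
    by move=> /Z'Y/sYZ'.
  move=> /wac/negP; apply; apply/forallP=> j; apply/negP=> /eqP Zj.
  have Zj0 : Z j != Zero by rewrite Zj.
  apply: noC; exists j; last by rewrite -cZ.
  by rewrite inE -ltNge (Zw j Zj0).
move=> _ /min_suppP[/imsetP[C CM ->] _]; apply/negP=> /forallP pos.
have [m Cm Hm] := supp_max w (circuit_neq0 CM).
have [a||i] := @strict_sublevel_contraction_acyclic w m Mac _ C CM.
- exact/positive_flatP.
- by exists m; rewrite ?inE ?ltxx.
rewrite inE -leNgt => mi Ci.
by have := pos i; rewrite (initial_formE _ Cm Hm) mi Ci.
Qed.

End InitialForms.

(** * Gaps of a weight vector *)

Section Gaps.
Variables (R : realType) (n : nat).
Implicit Types (w u : 'rV[R]_n) (F G : {set 'I_n}) (x : {set 'I_n} -> R).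

(** For [F] nonempty and proper, the length of the interval of thresholds
    [t] for which the set of [i] with [w 0 i <= t] is [F]. The default value
    of the minimum bounds all differences from above, so that it never
    matters, and it is continuous in [w]. *)
Definition gap w F : R :=
  if (F != finset.set0) && (F != [set: 'I_n]%SET) then
    Num.max 0 (\big[Num.min/ \sum_(p : 'I_n * 'I_n) `|w 0 p.1 - w 0 p.2|]_(
                 p : 'I_n * 'I_n | (p.1 \notin F) && (p.2 \in F))
                 (w 0 p.1 - w 0 p.2))
  else 0.

(** The nonempty proper sublevel sets, that is, the interior of the flag of
    [w]. *)
Definition gap_supp w : {set {set 'I_n}} := [set F | gap w F != 0]%SET.

Definition extremal w F i j := [/\ i \notin F, j \in F,
  forall k, k \notin F -> w 0 i <= w 0 k & forall k, k \in F -> w 0 k <= w 0 j].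

Lemma extremal_exists w F : F != finset.set0 -> F != [set: 'I_n]%SET ->
  exists i j, extremal w F i j.
Proof.
case/set0Pn=> j0 jF FT.
have [i0 iF] : exists i, i \notin F.
  apply/existsP; apply: contraR FT => /existsPn FT.
  by apply/eqP/setP=> i; rewrite inE -[_ \in _]negbK FT.
case: (@Order.TotalTheory.arg_maxP _ _ _ j0 (fun i => i \in F) (w 0) jF)
  => j jj Hj.
case: (@Order.TotalTheory.arg_minP _ _ _ i0 (fun i => i \notin F) (w 0) iF)
  => i ii Hi.
by exists i, j.
Qed.

Lemma gap_extremal w F i j : extremal w F i j ->
  gap w F = Num.max 0 (w 0 i - w 0 j).
Proof.
case=> iF jF Hi Hj; rewrite /gap ifT; last first.
  apply/andP; split; first by apply/set0Pn; exists j.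
  by apply: contraNneq iF => ->; rewrite inE.
congr Num.max; apply/le_anti/andP; split.
  by apply: (bigmin_le_cond _ (j := (i, j))) => //=; rewrite iF.
apply/bigmin_geP; split=> [|p /andP[p1 p2]].
  by rewrite (bigD1 (i, j)) //= (le_trans (ler_norm _)) // lerDl sumr_ge0.
by rewrite lerB ?Hi ?Hj.
Qed.

Lemma gap_ge0 w F : 0 <= gap w F.
Proof. by rewrite /gap; case: ifP => // _; rewrite le_max lexx. Qed.

Lemma gap_gt0 w F : (gap w F != 0) = (0 < gap w F).
Proof. by rewrite lt_neqAle gap_ge0 andbT eq_sym. Qed.

Lemma gap_suppP w F : F \in gap_supp w <->
  [/\ F != finset.set0, F != [set: 'I_n]%SET &
      forall j i, j \in F -> i \notin F -> w 0 j < w 0 i].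
Proof.
rewrite inE gap_gt0; split=> [|[F0 FT wF]].
  have [->|F0] := eqVneq F finset.set0; first by rewrite /gap eqxx ltxx.
  have [->|FT] := eqVneq F [set: 'I_n]%SET;
    first by rewrite /gap eqxx andbF ltxx.
  have [i [j ij]] := extremal_exists w F0 FT; rewrite (gap_extremal ij).
  case: ij => iF jF Hi Hj; rewrite lt_max ltxx subr_gt0 /= => wij;
    split=> // k l kF lF.
  by apply: le_lt_trans (Hj k kF) (lt_le_trans wij (Hi l lF)).
have [i [j ij]] := extremal_exists w F0 FT; rewrite (gap_extremal ij).
by case: ij => iF jF _ _; rewrite lt_max subr_gt0 wF ?orbT.
Qed.

Lemma gap_supp_sublevel w F : F \in gap_supp w -> exists a, F = sublevel w a.
Proof.
case/gap_suppP=> F0 FT wF; have [i [j [iF jF _ Hj]]] := extremal_exists w F0 FT.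
exists j; apply/setP=> k; rewrite inE; apply/idP/idP=> [/Hj//|].
by apply: contraTT => kF; rewrite -ltNge wF.
Qed.

Lemma sublevel_gap_supp w a : sublevel w a != [set: 'I_n]%SET ->
  sublevel w a \in gap_supp w.
Proof.
move=> aT; apply/gap_suppP; split=> //; first by apply/set0Pn; exists a;
  rewrite inE.
by move=> j i; rewrite !inE -ltNge; apply: le_lt_trans.
Qed.

Definition sep_by (S : {set {set 'I_n}}) a b :=
  exists F, [/\ F \in S, a \in F & b \notin F].

Lemma gap_supp_sep w a b : w 0 a < w 0 b <-> sep_by (gap_supp w) a b.
Proof.
split=> [ab|[F [/gap_suppP[_ _ wF] aF bF]]]; last exact: wF.
exists (sublevel w a); rewrite !inE lexx -ltNge ab; split=> //.
have := @sublevel_gap_supp w a; rewrite inE; apply.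
by apply/negP=> /eqP/setP/(_ b); rewrite !inE leNgt ab.
Qed.

(** The extremal pair for a gap set [F] is separated by some [G] in [S]; by
    extremality no element of [F] is outside [G] and conversely, so [G] is
    [F]. *)
Lemma gap_supp_unique w (S : {set {set 'I_n}}) :
  (forall F, F \in S -> F != finset.set0 /\ F != [set: 'I_n]%SET) ->
  (forall a b, w 0 a < w 0 b <-> sep_by S a b) -> gap_supp w = S.
Proof.
move=> S0 wS; apply/setP=> F; apply/idP/idP => [/gap_suppP[F0 FT wF]|FS];
  last first.
  apply/gap_suppP; have [F0 FT] := S0 F FS; split=> // j i jF iF.
  by apply/wS; exists F.
have [i [j [iF jF Hi Hj]]] := extremal_exists w F0 FT.
have /wS[G [GS jG iG]] := wF j i jF iF.
suff -> : F = G by [].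
apply/setP=> k; apply/idP/idP=> [kF|].
  apply/negPn/negP=> kG; have : w 0 j < w 0 k by apply/wS; exists G.
  by rewrite ltNge Hj.
apply: contraTT => kF; apply/negP=> kG.
have : w 0 k < w 0 i by apply/wS; exists G.
by rewrite ltNge Hi.
Qed.

Lemma gap_supp_chain w F G : F \in gap_supp w -> G \in gap_supp w ->
  (F \subset G) || (G \subset F).
Proof.
case/gap_suppP=> _ _ wF /gap_suppP[_ _ wG]; apply/orP.
have [|/subsetPn[a aF aG]] := boolP (F \subset G); first by left.
right; apply/fintype.subsetP=> b bG; apply/negPn/negP=> bF.
by have := lt_trans (wF a b aF bF) (wG b a bG aG); rewrite ltxx.
Qed.

(** The weight of [i] is the sum of the coefficients of the sets that must
    be passed before [i] is reached, so that sets in the support are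
    sublevel sets. *)
Definition climb x : 'rV[R]_n :=
  \row_i \sum_(F : {set 'I_n}) (if i \in F then 0 else x F).

(** Going up from [m] to [i], the weight increases by the gap of each
    sublevel set that is left. By induction on the number of elements below
    [i]: the last jump is the gap of the strict sublevel set [F0] of [i],
    and the other gap sets miss [i] exactly when they miss the top element
    [p] of [F0]. *)
Lemma climb_gap w m i : (forall j, w 0 m <= w 0 j) ->
  climb (gap w) 0 i = w 0 i - w 0 m.
Proof.
move=> Hm; rewrite mxE.
have [k] := ubnP #|[set j | w 0 j < w 0 i]%SET|; elim: k i => // k IH i lek.
have [im|mi] := leP (w 0 i) (w 0 m).
  have -> : w 0 i = w 0 m by apply/le_anti; rewrite im Hm.
  rewrite subrr big1 // => F _; case: ifPn => // iF; apply/eqP/negPn/negP=> gF.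
  have /gap_suppP[/set0Pn[j jF] _ wF] : F \in gap_supp w by rewrite inE.
  by have := lt_le_trans (wF j i jF iF) im; rewrite ltNge Hm.
case: (@Order.TotalTheory.arg_maxP _ _ _ m (fun j => w 0 j < w 0 i) (w 0) mi)
  => p pi Hp.
set F0 := [set j | w 0 j < w 0 i]%SET.
have ext : extremal w F0 i p.
  split; rewrite ?inE ?ltxx // => l; rewrite inE; last exact: Hp.
  by rewrite -leNgt.
have -> : w 0 i - w 0 m = gap w F0 + (w 0 p - w 0 m).
  by rewrite (gap_extremal ext) max_r ?subrKA // subr_ge0 ltW.
rewrite -IH; last first.
  rewrite -ltnS; apply: leq_trans lek; rewrite ltnS; apply/proper_card/properP;
    split.
    by apply/fintype.subsetP=> l; rewrite !inE => /lt_trans; apply.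
  by exists p; rewrite !inE ?ltxx.
rewrite (bigD1 F0) //= [in RHS](bigD1 F0) //=.
case: ext => iF pF Hi _; rewrite (negbTE iF) pF add0r; congr (_ + _).
apply: eq_bigr => F FF0; have [|gF] := boolP (F \in gap_supp w); last first.
  by move: gF; rewrite inE negbK => /eqP->; rewrite !if_same.
case/gap_suppP=> _ _ wF.
suff -> : (i \in F) = (p \in F) by [].
apply/idP/idP=> [|pF'].
  by apply: contraTT => pF'; apply/negP=> iF'; have := wF _ _ iF' pF';
    rewrite ltNge ltW.
apply/negPn/negP=> iF'; case/eqP: FF0; apply/setP=> l; rewrite [in RHS]inE.
apply/idP/idP=> [lF|li]; first exact: wF.
by apply/negPn/negP=> lF; have := lt_le_trans (wF _ _ pF' lF) (Hp l li);
  rewrite ltxx.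
Qed.

Section ChainSupport.
Variable x : {set 'I_n} -> R.
Hypothesis x0 : forall F, 0 <= x F.
Hypothesis xch : forall F G, x F != 0 -> x G != 0 ->
  (F \subset G) || (G \subset F).

Lemma climb_le G a b : x G != 0 -> a \in G -> b \notin G ->
  climb x 0 a + x G <= climb x 0 b.
Proof.
move=> xG aG bG; rewrite !mxE (bigD1 G) //= [in leRHS](bigD1 G) //=.
rewrite aG (negbTE bG).
rewrite add0r [leRHS]addrC lerD2r; apply: ler_sum => F FG.
have [->|xF] := eqVneq (x F) 0; first by rewrite !if_same.
case: (ifPn (b \in F)) => bF; case: ifPn => aF //.
have /orP[/fintype.subsetP GF|/fintype.subsetP FG'] := xch xG xF.
  by rewrite GF in aF.
by rewrite FG' in bG.
Qed.

Lemma climb_lt G a b : x G != 0 -> a \in G -> b \notin G ->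
  climb x 0 a < climb x 0 b.
Proof.
move=> xG aG bG; apply: lt_le_trans (climb_le xG aG bG).
by rewrite ltrDl lt_neqAle x0 andbT eq_sym.
Qed.

Hypothesis xprop : forall F, x F != 0 ->
  F != finset.set0 /\ F != [set: 'I_n]%SET.

(** For an extremal pair [i], [j] of [F], any [G] other than [F] in the
    support that contains [j] but not [i] would, by monotonicity, contain
    all of [F] and nothing else. So at most the term of [F] contributes to
    the difference of the weights at [i] and [j]; monotonicity also gives
    the lower bound. *)
Lemma gap_climb F : gap (climb x) F = x F.
Proof.
have [F0|F0] := eqVneq F finset.set0.
  rewrite /gap F0 eqxx; apply/esym/eqP/negPn/negP=> /xprop.
  by rewrite eqxx => -[].
have [FT|FT] := eqVneq F [set: 'I_n]%SET.
  rewrite /gap FT eqxx andbF; apply/esym/eqP/negPn/negP=> /xprop.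
  by rewrite eqxx => -[].
have [i [j ij]] := extremal_exists (climb x) F0 FT; rewrite (gap_extremal ij).
case: ij => iF jF Hi Hj; apply/le_anti/andP; split.
  rewrite ge_max x0 /= lerBlDr !mxE (bigD1 F) //= (negbTE iF) lerD2l.
  rewrite [leRHS](bigD1 F) //= jF add0r; apply: ler_sum => G GF.
  have [->|xG] := eqVneq (x G) 0; first by rewrite !if_same.
  case: (ifPn (i \in G)) => iG; case: ifPn => jG //.
  case/eqP: GF; apply/setP=> k; apply/idP/idP=> [kG|kF].
    apply/negPn/negP=> kF; have := climb_lt xG kG iG.
    by rewrite ltNge Hi.
  apply/negPn/negP=> kG; have := climb_lt xG jG kG.
  by rewrite ltNge Hj.
rewrite le_max; have [->|xF] := eqVneq (x F) 0; first by rewrite lexx.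
by rewrite lerBrDl climb_le ?orbT.
Qed.

End ChainSupport.

End Gaps.

(** * Flags *)

Section Flags.
Variables (R : realType) (n : nat).
Implicit Types (w : 'rV[R]_n) (s : seq {set 'I_n}).

Definition full_flag s : seq {set 'I_n} :=
  finset.set0 :: rcons s [set: 'I_n]%SET.

Lemma set_lt_trans : transitive (@set_lt 'I_n).
Proof. by move=> B A C; apply: proper_trans. Qed.

Lemma set_lt_irr : irreflexive (@set_lt 'I_n).
Proof. by move=> A; rewrite /set_lt fintype.properxx. Qed.

Section FullFlag.
Variable s : seq {set 'I_n}.
Hypothesis sflag : is_flag (full_flag s).
Let L := full_flag s.

Lemma size_full_flag : size L = (size s).+2.
Proof. by rewrite /= size_rcons. Qed.

Lemma full_flag_proper i : (i.+1 < size L)%N ->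
  nth finset.set0 L i \proper nth finset.set0 L i.+1.
Proof.
move=> iL; case/and3P: sflag => _ _ sL.
by apply: (sorted_ltn_nth set_lt_trans finset.set0 sL) => //;
  rewrite inE // ltnW.
Qed.

Lemma full_flag_mono i j a : (i <= j < size L)%N ->
  a \in nth finset.set0 L i -> a \in nth finset.set0 L j.
Proof.
case/andP; rewrite leq_eqVlt => /orP[/eqP->//|ij] jL;
  apply/fintype.subsetP/proper_sub.
case/and3P: sflag => _ _ sL.
by apply: (sorted_ltn_nth set_lt_trans finset.set0 sL) => //;
  rewrite inE // (ltn_trans ij).
Qed.

Lemma flag_block_size i a : a \in flag_block L i -> (i.+1 < size L)%N.
Proof.
rewrite inE; case: ltnP => // /(nth_default finset.set0)->.
by rewrite inE andbF.
Qed.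

Lemma flag_block_neq0 i : (i.+1 < size L)%N -> exists a, a \in flag_block L i.
Proof.
by move/full_flag_proper/properP => [_ [a aS aN]]; exists a; rewrite inE aN.
Qed.

Lemma flag_block_exists a : exists i, a \in flag_block L i.
Proof.
pose p := (fun F : {set 'I_n} => a \in F).
have hasL : has p L.
  by apply/hasP; exists [set: 'I_n]%SET;
    rewrite /p ?inE // mem_rcons inE eqxx orbT.
have := nth_find finset.set0 hasL; have := @before_find _ finset.set0 p L.
case: (find p L) => [|m] H pm; first by rewrite /p inE in pm.
by exists m; rewrite inE [X in _ && X]pm andbT; have := H m (ltnSn m);
  rewrite /p => ->.
Qed.

(** The sets of the flag that contain [a] but not [b] are those strictly
    after the block of [a] and not after the block of [b]. *)
Lemma flag_block_sep i j a b : a \in flag_block L i -> b \in flag_block L j ->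
  sep_by [set:: s]%SET a b <-> (i < j)%N.
Proof.
move=> ai bj; have iL := flag_block_size ai; have jL := flag_block_size bj.
move: ai bj; rewrite !inE => /andP[aNi ai] /andP[bNj bj].
have Ls k : (k < size s)%N -> nth finset.set0 L k.+1 = nth finset.set0 s k.
  by move=> ks; rewrite /= nth_rcons ks.
split=> [[F [FS aF bF]]|ij].
  move: FS; rewrite inE => /(nthP finset.set0)[k ks Fk].
  rewrite -Fk -Ls // in aF bF.
  apply: (@leq_ltn_trans k); rewrite leqNgt; apply/negP => H.
    by case/negP: aNi; apply: full_flag_mono aF; rewrite H ltnW.
  by case/negP: bF; apply: full_flag_mono bj;
    rewrite H size_full_flag !ltnS ltnW.
have si : (i < size s)%N.
  by move: jL; rewrite size_full_flag !ltnS; apply: leq_trans.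
exists (nth finset.set0 L i.+1); split=> //.
  by rewrite inE Ls // mem_nth.
by apply: contraNN bNj; apply: full_flag_mono; rewrite ij ltnW.
Qed.

(** Weights increase along consecutive blocks, hence along all blocks; as
    the blocks cover everything, the flag condition determines the weight
    order. *)
Lemma flag_ofP w : flag_of w L <->
  forall a b, w 0 a < w 0 b <-> sep_by [set:: s]%SET a b.
Proof.
split=> [[_ weq wlt] a b|wS]; last first.
  split=> // i a b ai bi.
    apply/le_anti; rewrite !leNgt; apply/andP; split; apply/negP => /wS.
      by rewrite (flag_block_sep bi ai) ltnn.
    by rewrite (flag_block_sep ai bi) ltnn.
  by apply/wS/(flag_block_sep ai bi).
have [i ai] := flag_block_exists a; have [j bj] := flag_block_exists b.
rewrite (flag_block_sep ai bj).
have mono k c d l : c \in flag_block L k -> d \in flag_block L (k + l).+1 ->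
  w 0 c < w 0 d.
  elim: l d => [|l IH] d ck dl; first by rewrite addn0 in dl; apply: wlt ck dl.
  have [|e ekl] := @flag_block_neq0 (k + l).+1.
    by have := flag_block_size dl; rewrite addnS; apply: ltnW.
  by apply: lt_trans (IH e ck ekl) _; apply: wlt ekl _; rewrite -addnS.
case: (ltngtP i j) => ij; split=> // H.
- by apply: (mono i a b (j - i.+1)%N ai); rewrite -addSn subnKC.
- have := mono j b a (i - j.+1)%N bj; rewrite -addSn subnKC // => /(_ ai).
  by move=> /(lt_trans H); rewrite ltxx.
- by move: H; rewrite (weq i a b ai) ?ltxx // ij.
Qed.

End FullFlag.

Lemma is_full_flag s :
  all (fun F => (F != finset.set0) && (F != [set: 'I_n]%SET)) s ->
  (0 < n)%N -> sorted (@set_lt _) s -> is_flag (full_flag s).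
Proof.
move=> sP n0 ss; rewrite /is_flag /full_flag /= eqxx last_rcons eqxx /=.
case: s sP ss => [|F s] /= sP ss.
  by rewrite andbT /set_lt properT; apply/eqP=> /setP/(_ (Ordinal n0));
    rewrite !inE.
rewrite rcons_path ss /=.
rewrite /set_lt proper0; case/andP: sP => /andP[-> FT] sP /=.
rewrite properT; have := mem_last F s; rewrite inE => /orP[/eqP->//|].
by move=> /(allP sP)/andP[].
Qed.

Lemma is_flag_full L : (0 < n)%N -> is_flag L -> exists s, L = full_flag s.
Proof.
move=> n0; case: L => [|F L] // /and3P[/= /eqP[->]] + _.
case/lastP: L => [|s G] /=.
  by move=> /eqP/setP/(_ (Ordinal n0)); rewrite !inE.
by rewrite last_rcons => /eqP->; exists s.
Qed.

Lemma full_flag_sorted s : is_flag (full_flag s) -> sorted (@set_lt _) s.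
Proof.
case/and3P=> _ _; rewrite /full_flag /= => /path_sorted.
by case: s => //= F s; rewrite rcons_path => /andP[].
Qed.

Lemma full_flag_proper_sets s F : is_flag (full_flag s) -> F \in s ->
  F != finset.set0 /\ F != [set: 'I_n]%SET.
Proof.
case/and3P=> _ _; rewrite /full_flag /=.
rewrite (path_sortedE set_lt_trans) all_rcons => /andP[/andP[_ /allP s0] sT] Fs.
have := s0 F Fs; rewrite /set_lt proper0 => ->; split=> //.
have : sorted (@set_lt 'I_n) (rcons s [set: 'I_n]%SET) by [].
rewrite -rev_sorted rev_rcons /= (path_sortedE); last first.
  by move=> A B C /= ltAB ltCA; apply: set_lt_trans ltCA ltAB.
by move=> /andP[/allP/(_ F)]; rewrite mem_rev => /(_ Fs);
  rewrite /set_lt properT.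
Qed.

(** Both conditions say that the order of the weights is given by separation
    by members of [s], and [gap_supp_unique] recovers the sets from this
    relation. *)
Lemma flag_of_gap_supp w s : is_flag (full_flag s) ->
  flag_of w (full_flag s) <-> gap_supp w = [set:: s]%SET.
Proof.
move=> fs; rewrite flag_ofP //; split=> [H|<- a b]; last exact: gap_supp_sep.
apply: gap_supp_unique H => F; rewrite inE; exact: full_flag_proper_sets.
Qed.

Lemma flag_of_inj w s t :
  flag_of w (full_flag s) -> flag_of w (full_flag t) -> s = t.
Proof.
move=> fs ft; have [is_s _ _] := fs; have [is_t _ _] := ft.
apply: (irr_sorted_eq set_lt_trans set_lt_irr); rewrite ?full_flag_sorted //.
move/(flag_of_gap_supp _ is_s): fs => fs;
  move/(flag_of_gap_supp _ is_t): ft => ft.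
have st : [set:: s]%SET = [set:: t]%SET by rewrite -fs.
by move=> F; have := congr1 (fun S : {set {set 'I_n}} => F \in S) st;
  rewrite !inE.
Qed.

Lemma flag_of_exists w : (0 < n)%N -> exists s, flag_of w (full_flag s).
Proof.
move=> n0; pose s := sort (fun A B : {set 'I_n} => A \subset B)
  (enum (gap_supp w)).
have memS F : (F \in s) = (F \in gap_supp w) by rewrite mem_sort mem_enum.
have fs : is_flag (full_flag s).
  apply: is_full_flag => //.
    by apply/allP=> F; rewrite memS => /gap_suppP[-> ->].
  have us : uniq s by rewrite sort_uniq enum_uniq.
  have ss : sorted (fun A B : {set 'I_n} => A \subset B) s.
    apply: (@sort_sorted_in _ (mem (gap_supp w))); last by apply/allP=> F;
      rewrite mem_enum.
    by move=> F G FS GS; apply: gap_supp_chain FS GS.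
  have sub_tr : transitive (fun A B : {set 'I_n} => A \subset B).
    by move=> B A C; apply: fintype.subset_trans.
  have : pairwise [rel A B : {set 'I_n} | (A != B) && (A \subset B)] s.
    by rewrite pairwise_relI -uniq_pairwise us -sorted_pairwise.
  move/pairwise_sorted; apply: sub_sorted => A B.
  by rewrite /set_lt /= finset.properEneq.
exists s; apply/(flag_of_gap_supp _ fs); apply/setP=> F; rewrite !inE.
by rewrite memS inE.
Qed.

End Flags.

Local Open Scope classical_set_scope.

(** * Limits in finite products *)

Section Continuity.
Variables (R : realType).

Lemma cvg_ptws (T : Type) (V : choiceType) (F : set_system T) {FF : Filter F}
    (f : T -> {ptws V -> R}) (l : {ptws V -> R}) :
  (forall v, (f x v : R) @[x --> F] --> (l v : R)) -> f @ F --> l.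
Proof.
move=> fl; apply/cvg_sup => v A; rewrite nbhsE => -[B [[W oW <-] Wl] sBA].
apply: filterS sBA _; apply: (fl v); exact: open_nbhs_nbhs.
Qed.

Lemma cvg_row (T : Type) n (F : set_system T) {FF : Filter F}
    (f : T -> 'rV[R]_n) (l : 'rV[R]_n) :
  (forall i, (f x 0 i : R) @[x --> F] --> (l 0 i : R)) -> f @ F --> l.
Proof.
move=> fl A [P Pl sPA]; apply: filterS sPA _ => /=.
apply: filter_forall => i; apply: filter_forall => j.
by rewrite ord1; apply: fl; have := Pl 0 j.
Qed.

Lemma eval_ptws_continuous (V : choiceType) (v : V) :
  continuous (fun x : {ptws V -> R} => x v : R).
Proof. exact: proj_continuous. Qed.

Lemma cvg_sum_fin (T I : Type) (F : set_system T) {FF : Filter F}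
    (r : seq I) (P : pred I)
  (f : I -> T -> R) (l : I -> R) : (forall i, f i x @[x --> F] --> l i) ->
  \sum_(i <- r | P i) f i x @[x --> F] --> \sum_(i <- r | P i) l i.
Proof. by move=> fl; apply: cvg_big => // ; exact: add_continuous. Qed.

Lemma cvg_bigmin (T I : Type) (F : set_system T) {FF : Filter F}
    (r : seq I) (P : pred I)
    (d : T -> R) (d0 : R) (f : I -> T -> R) (l : I -> R) :
  d x @[x --> F] --> d0 -> (forall i, f i x @[x --> F] --> l i) ->
  \big[Num.min/d x]_(i <- r | P i) f i x @[x --> F] -->
    \big[Num.min/d0]_(i <- r | P i) l i.
Proof.
move=> cd cf; elim: r => [|i r IH].
  by rewrite big_nil; under eq_cvg => x do rewrite big_nil.
rewrite big_cons; under eq_cvg => x do rewrite big_cons.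
case: ifP => // _.
apply: (@cvg_comp _ _ _
  (fun x => (f i x, \big[Num.min/d x]_(j <- r | P j) f j x))
  (fun x : R * R => Num.min x.1 x.2) _ _ _ (cvg_pair (cf i) IH)).
exact: (@min_continuous _ R (l i, _)).
Qed.

Lemma cvg_maxr (T : Type) (F : set_system T) {FF : Filter F} (f g : T -> R)
    (a b : R) : f x @[x --> F] --> a -> g x @[x --> F] --> b ->
  Num.max (f x) (g x) @[x --> F] --> Num.max a b.
Proof.
move=> fa gb.
apply: (@cvg_comp _ _ _ (fun x => (f x, g x))
  (fun x : R * R => Num.max x.1 x.2) _ _ _ (cvg_pair fa gb)).
exact: (@max_continuous _ R (a, b)).
Qed.
End Continuity.

(** * Normalization to the sphere *)

Section Normalization.
Variables (R : realType) (n : nat).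
Implicit Types (w u : 'rV[R]_n) (F G : {set 'I_n}).

Definition mean u : R := (\sum_i u 0 i) / n%:R.
Definition deviation u : R := Num.sqrt (\sum_i (u 0 i - mean u) ^+ 2).
(** A positive affine change of the weights, so that the order of the
    weights and the ratios of the gaps are kept. *)
Definition normalize u : 'rV[R]_n := \row_i ((u 0 i - mean u) / deviation u).

Lemma deviation_gt0 u a b : u 0 a < u 0 b -> 0 < deviation u.
Proof.
move=> ab; rewrite sqrtr_gt0 lt_neqAle sumr_ge0 => [|i _]; last exact: sqr_ge0.
rewrite andbT eq_sym; apply/negP => /eqP/psumr_eq0P H.
have E i : u 0 i = mean u.
  by apply/eqP; rewrite -subr_eq0 -sqrf_eq0 H // => j _; apply: sqr_ge0.
by move: ab; rewrite !E ltxx.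
Qed.

Lemma normalize_sphere u : (0 < n)%N -> 0 < deviation u -> sphere (normalize u).
Proof.
move=> n0 u0; split.
  under eq_bigr => i _ do rewrite mxE.
  rewrite -mulr_suml sumrB sumr_const card_ord /mean -[_ *+ n]mulr_natr divfK.
    by rewrite subrr mul0r.
  by rewrite pnatr_eq0 -lt0n.
under eq_bigr => i _ do rewrite mxE expr_div_n.
rewrite -mulr_suml sqr_sqrtr; last by apply: sumr_ge0 => i _; apply: sqr_ge0.
by rewrite divff // gt_eqF // -sqrtr_gt0.
Qed.

Lemma sphere_gt0 w : sphere w -> (0 < n)%N.
Proof.
case=> _; case: n w => // w; rewrite big_ord0 => /eqP.
by rewrite eq_sym oner_eq0.
Qed.

(** A constant vector with zero sum is zero, so its squares do not sum to
    one. *)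
Lemma sphere_lt w : sphere w -> exists a b, w 0 a < w 0 b.
Proof.
move=> sw; have n0 := sphere_gt0 sw; case: sw => w0 w1.
apply: contra_notP (elimN eqP (oner_neq0 R)) => H.
pose o := Ordinal n0.
have E i : w 0 i = w 0 o.
  by apply/le_anti; rewrite !leNgt; apply/andP; split; apply/negP=> ?; apply: H;
    [exists o, i|exists i, o].
have o0 : w 0 o = 0.
  apply/eqP; move: w0; rewrite (eq_bigr _ (fun i _ => E i))
    sumr_const card_ord => /eqP.
  by rewrite mulrn_eq0 => /orP[|//]; rewrite -leqn0 leqNgt n0.
by rewrite -w1 big1 // => i _; rewrite E o0 expr0n.
Qed.

Lemma normalize_affine w u c d : sphere w -> 0 < c ->
  (forall i, u 0 i = c * w 0 i + d) -> normalize u = w.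
Proof.
move=> sw c0 uw; have n0 := sphere_gt0 sw; case: sw => w0 w1.
have mu : mean u = d.
  rewrite /mean (eq_bigr _ (fun i _ => uw i))
    big_split /= -mulr_sumr w0 mulr0 add0r.
  by rewrite sumr_const card_ord -[_ *+ n]mulr_natr mulfK // pnatr_eq0 -lt0n.
have cu i : u 0 i - mean u = c * w 0 i by rewrite mu uw addrK.
have du : deviation u = c.
  rewrite /deviation; under eq_bigr => i _ do rewrite cu exprMn.
  by rewrite -mulr_sumr w1 mulr1 sqrtr_sqr ger0_norm // ltW.
by apply/rowP=> i; rewrite mxE cu du mulrC mulKf // gt_eqF.
Qed.

Lemma normalizeE u : 0 < deviation u ->
  exists c d, 0 < c /\ forall i, normalize u 0 i = c * u 0 i + d.
Proof.
move=> du; exists (deviation u)^-1, (- mean u / deviation u); split;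
  first by rewrite invr_gt0.
by move=> i; rewrite mxE mulrDl mulrC.
Qed.

Lemma gap_affine w u c d F : 0 < c -> (forall i, u 0 i = c * w 0 i + d) ->
  gap u F = c * gap w F.
Proof.
move=> c0 uw.
have [F0|F0] := eqVneq F finset.set0; first by rewrite /gap F0 eqxx mulr0.
have [FT|FT] := eqVneq F [set: 'I_n]%SET;
  first by rewrite /gap FT eqxx andbF mulr0.
have [i [j ij]] := extremal_exists w F0 FT.
have uij : extremal u F i j.
  by case: ij => iF jF Hi Hj; split=> // k kF;
    rewrite !uw lerD2r ler_pM2l ?Hi ?Hj.
rewrite (gap_extremal uij) (gap_extremal ij)
  !uw opprD addrACA subrr addr0 -mulrBr.
by rewrite maxr_pMr ?mulr0 ?ltW.
Qed.

Section Limits.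
Variables (T : Type) (E : set_system T).
Context {EE : Filter E}.
Variables (v : T -> 'rV[R]_n) (u : 'rV[R]_n).
Hypothesis vu : forall i, (v t 0 i : R) @[t --> E] --> (u 0 i : R).

Lemma normalize_cvg i : 0 < deviation u ->
  (normalize (v t) 0 i : R) @[t --> E] --> (normalize u 0 i : R).
Proof.
move=> du.
have cm : mean (v t) @[t --> E] --> mean u.
  by rewrite /mean; apply: cvgM; [exact: cvg_sum_fin|exact: cvg_cst].
have cb j : v t 0 j - mean (v t) @[t --> E] --> u 0 j - mean u by apply: cvgB.
under eq_cvg => t do rewrite mxE.
rewrite mxE; apply: cvgM => //; apply: cvgV; first by rewrite gt_eqF.
apply: (@cvg_comp _ _ _ (fun t => \sum_j (v t 0 j - mean (v t)) ^+ 2)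
  (@Num.sqrt R)
  _ _ _ _ (@sqrt_continuous R _)).
apply: cvg_sum_fin => j.
under eq_cvg => t do rewrite expr2.
by rewrite expr2; apply: cvgM.
Qed.

Lemma gap_cvg F : gap (v t) F @[t --> E] --> gap u F.
Proof.
rewrite /gap; case: ifP => _; last exact: cvg_cst.
have cd (p : 'I_n * 'I_n) :
    v t 0 p.1 - v t 0 p.2 @[t --> E] --> u 0 p.1 - u 0 p.2.
  by apply: cvgB.
apply: cvg_maxr; first exact: cvg_cst.
by apply: cvg_bigmin => //; apply: cvg_sum_fin => p; apply: cvg_norm.
Qed.

Lemma gap_ratio_cvg F : \sum_G gap u G != 0 ->
  gap (v t) F / \sum_G gap (v t) G @[t --> E] --> gap u F / \sum_G gap u G.
Proof.
move=> u0; apply: cvgM; first exact: gap_cvg.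
by apply: cvgV => //; apply: cvg_sum_fin => G; apply: gap_cvg.
Qed.

End Limits.

Lemma climb_cvg (T : Type) (E : set_system T) {EE : Filter E}
    (x : T -> {set 'I_n} -> R) (y : {set 'I_n} -> R) i :
  (forall F, x t F @[t --> E] --> y F) ->
  (climb (x t) 0 i : R) @[t --> E] --> (climb y 0 i : R).
Proof.
move=> xy; rewrite mxE; under eq_cvg => t do rewrite mxE.
by apply: cvg_sum_fin => F; case: ifP => _ //; exact: cvg_cst.
Qed.

End Normalization.

(** * The homeomorphism *)

Section Homeomorphism.
Variables (R : realType) (n : nat).

Definition realize (x : {ptws {set 'I_n} -> R}) : 'rV[R]_n :=
  normalize (climb x).

(** The barycentric coordinate of a sublevel set is its share of the total
    range of the weights, as the gaps sum to the difference of extreme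
    weights. *)
Definition barycentric (w : 'rV[R]_n) : {ptws {set 'I_n} -> R} :=
  fun F => gap w F / \sum_G gap w G.

Lemma realize_continuous (x : {ptws {set 'I_n} -> R}) :
  0 < deviation (climb x) -> {for x, continuous realize}.
Proof.
move=> dx; apply: (@cvg_row _ _ _ (nbhs x)) => i.
apply: normalize_cvg => // j; apply: climb_cvg => F.
exact: eval_ptws_continuous.
Qed.

Lemma barycentric_continuous (w : 'rV[R]_n) :
  \sum_G gap w G != 0 -> {for w, continuous barycentric}.
Proof.
move=> dw; apply: (@cvg_ptws _ _ _ (nbhs w)) => F.
apply: (@gap_ratio_cvg _ _ _ (nbhs w) _ id) => // i; exact: coord_continuous.
Qed.

End Homeomorphism.

Section Bijection.
Variables (R : realType) (n : nat) (M : oriented_matroid n).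
Hypothesis M_acyclic : acyclic (circuits M).
Let P := las_vergnas_proper_part M.
Let Delta := order_complex (@set_le 'I_n) P.
Implicit Types (w : 'rV[R]_n) (x : {ptws {set 'I_n} -> R}) (F G : {set 'I_n}).

Lemma las_vergnas_properP F :
  F \in P <-> [/\ F != finset.set0, F != [set: 'I_n]%SET & positive_flat M F].
Proof.
rewrite /P finset.inE !finset.inE negb_or; split.
  by case/andP=> /andP[F0 FT] /asboolP.
by case=> -> -> F0; apply/asboolP.
Qed.

(** The gap sets are the sublevel sets other than the full set, which is a
    positive flat by convention. *)
Lemma positive_bergman_gapP w : sphere w ->
  positive_bergman M w <-> gap_supp w \subset P.
Proof.
move=> sw; split.
  case=> _ /(initial_circuits_acyclicP _ M_acyclic) wM.
  apply/fintype.subsetP=> F Fw; apply/las_vergnas_properP.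
  by have /gap_suppP[F0 FT _] := Fw; have [a Fa] := gap_supp_sublevel Fw;
    rewrite Fa in F0 FT *.
move/fintype.subsetP=> wP.
split=> //; apply/(initial_circuits_acyclicP _ M_acyclic) => a.
have [->|aT] := eqVneq (sublevel w a) [set: 'I_n]%SET; first by right.
by have /las_vergnas_properP[] := wP _ (sublevel_gap_supp aT).
Qed.

Lemma realization_support x : realization Delta x ->
  [/\ forall F, 0 <= x F, \sum_F x F = 1,
  forall F, x F != 0 -> F \in P &
  forall F G, x F != 0 -> x G != 0 -> (F \subset G) || (G \subset F)].
Proof.
case=> x0 x1; rewrite inE => /andP[/fintype.subsetP xP /forall_inP xch];
  split=> //.
  by move=> F xF; apply: xP; rewrite inE.
move=> F G xF xG; have /forall_inP := xch F ltac:(by rewrite inE).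
by apply; rewrite inE.
Qed.

Lemma climb_deviation_gt0 x : realization Delta x ->
  (0 < n)%N /\ 0 < deviation (climb x).
Proof.
case/realization_support=> x0 x1 xP xch.
have [G xG] : exists G, x G != 0.
  apply: contra_notP (elimN eqP (oner_neq0 R)) => noG;
    rewrite -x1 big1 // => F _.
  by apply/eqP/negPn/negP=> xF; apply: noG; exists F.
have /las_vergnas_properP[G0 GT _] := xP G xG.
have [i [j [iG jG _ _]]] := extremal_exists (climb x) G0 GT.
split; first exact: leq_ltn_trans (ltn_ord i).
exact: deviation_gt0 (climb_lt x0 xch xG jG iG).
Qed.

(** Normalization is a positive affine change of weights, which scales all
    gaps by one factor; the gaps of [climb x] are the coordinates of [x]. *)
Lemma realize_gap x : realization Delta x ->
  sphere (realize x) /\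
  exists2 c, 0 < c & forall F, gap (realize x) F = c * x F.
Proof.
move=> xr; have [n0 dx] := climb_deviation_gt0 xr.
case/realization_support: xr => x0 x1 xP xch.
have xprop F : x F != 0 -> F != finset.set0 /\ F != [set: 'I_n]%SET.
  by move=> /xP/las_vergnas_properP[].
split; first exact: normalize_sphere.
have [c [d [c0 cd]]] := normalizeE dx.
exists c => // F; rewrite (gap_affine F c0 cd); congr (_ * _).
exact: gap_climb.
Qed.

Lemma realize_gap_supp x : realization Delta x ->
  gap_supp (realize x) = [set F | x F != 0]%SET.
Proof.
move=> /realize_gap[_ [c c0 xc]]; apply/setP=> F; rewrite !inE xc mulf_eq0.
by rewrite gt_eqF.
Qed.

Lemma realize_bergman x : realization Delta x -> positive_bergman M (realize x).
Proof.
move=> xr; have [sx _] := realize_gap xr; apply/positive_bergman_gapP => //.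
rewrite (realize_gap_supp xr); apply/fintype.subsetP=> F; rewrite inE.
by case/realization_support: xr => _ _ + _; apply.
Qed.

Lemma realizeK x : realization Delta x -> barycentric (realize x) = x.
Proof.
move=> xr; have [_ [c c0 xc]] := realize_gap xr; apply: funext => F.
have x1 : \sum_F x F = 1 by case/realization_support: xr.
rewrite /barycentric (eq_bigr _ (fun G _ => xc G)) -mulr_sumr x1 mulr1 xc.
by rewrite mulrC mulKf // gt_eqF.
Qed.

Lemma gap_sum_gt0 w : sphere w -> 0 < \sum_F gap w F.
Proof.
move=> /sphere_lt[a [b /gap_supp_sep[F [wF _ _]]]].
rewrite (bigD1 F) //= ltr_wpDr ?sumr_ge0 // => [G _|]; first exact: gap_ge0.
by rewrite -gap_gt0; rewrite inE in wF.
Qed.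

Lemma barycentric_supp w : sphere w ->
  [set F | barycentric w F != 0]%SET = gap_supp w.
Proof.
move=> /gap_sum_gt0 w0; apply/setP=> F; rewrite !inE mulf_eq0 invr_eq0.
by rewrite (gt_eqF w0) orbF.
Qed.

Lemma barycentric_ge0 w F : sphere w -> 0 <= barycentric w F.
Proof. by move=> /gap_sum_gt0 w0; rewrite divr_ge0 ?gap_ge0 // ltW. Qed.

Lemma barycentric_sum w : sphere w -> \sum_F barycentric w F = 1.
Proof. by move=> /gap_sum_gt0 w0; rewrite -mulr_suml divff // gt_eqF. Qed.

Lemma barycentric_realization w : positive_bergman M w ->
  realization Delta (barycentric w).
Proof.
move=> wB; have [sw _] := wB; split; first by move=> F; apply: barycentric_ge0.
  exact: barycentric_sum.
rewrite barycentric_supp // inE; apply/andP; split;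
  first exact/positive_bergman_gapP.
apply/forall_inP=> F wF; apply/forall_inP=> G wG; exact: gap_supp_chain wF wG.
Qed.

(** Climbing along the barycentric coordinates gives back the weights up to
    a positive affine change, which normalization undoes. *)
Lemma barycentricK w : sphere w -> realize (barycentric w) = w.
Proof.
move=> sw; have w0 := gap_sum_gt0 sw; have [a _] := sphere_lt sw.
case: (@Order.TotalTheory.arg_minP _ _ _ a predT (w 0) isT) => m _ Hm.
apply: (@normalize_affine _ _ _ _
  (\sum_F gap w F)^-1 (- w 0 m / \sum_F gap w F) sw).
  by rewrite invr_gt0.
move=> i; rewrite mulrC -mulrDl -(climb_gap i (fun j => Hm j isT))
  !mxE mulr_suml.
by apply: eq_bigr => F _; case: ifP; rewrite ?mul0r.
Qed.

Lemma realize_homeomorphism :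
  homeomorphism_on (realization Delta) (positive_bergman M) (@realize R n).
Proof.
split.
- split; first by move=> x; apply: realize_bergman.
    move=> x y; rewrite !inE => xr yr xy.
    by rewrite -(realizeK xr) xy realizeK.
  move=> w wB; exists (barycentric w); first exact: barycentric_realization.
  by apply: barycentricK; case: wB.
- apply: continuous_in_subspaceT => x; rewrite inE => xr;
  apply: realize_continuous.
  by have [] := climb_deviation_gt0 xr.
exists (@barycentric R n); split; last exact: realizeK.
apply: continuous_in_subspaceT => w; rewrite inE => -[sw _].
by apply: barycentric_continuous; rewrite gt_eqF // gap_sum_gt0.
Qed.

(** The support of [x] and the flag of [realize x] are the same chain, so
    the open simplex on [s] consists of the points whose image has flag [s]. *)
Lemma realize_open_simplex (s : seq {set 'I_n}) : nonempty_chain P s ->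
  @realize R n @` open_simplex [set:: s]%SET = weight_cell s.
Proof.
case=> s0 /allP sP ss.
have n0 : (0 < n)%N.
  case: (s) s0 sP => // F t _ /(_ F (mem_head _ _)).
  case/las_vergnas_properP=> /set0Pn[i _] _ _.
  exact: leq_ltn_trans (ltn_ord i).
have fs : is_flag (full_flag s).
  apply: is_full_flag => //; apply/allP=> F /sP/las_vergnas_properP[-> -> //].
have sch F G : F \in s -> G \in s -> set_le F G || set_le G F.
  have sle : sorted (@set_le 'I_n) s by apply: sub_sorted ss => A B /proper_sub.
  have tle : transitive (@set_le 'I_n).
    by move=> B A C; apply: fintype.subset_trans.
  have rle : reflexive (@set_le 'I_n) by move=> A; apply: subxx.
  move=> Fs Gs; case: (leqP (index F s) (index G s)) => [FG|/ltnW GF];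
    apply/orP.
    by left; apply: (sorted_leq_index tle rle sle).
  by right; apply: (sorted_leq_index tle rle sle).
apply/seteqP; split=> [_ [x [xpos x0 x1] <-]|w [sw /(flag_of_gap_supp _ fs)
  ws]].
  have xs : [set F | x F != 0]%SET = [set:: s]%SET.
    apply/setP=> F; rewrite !inE; have [Fs|Fs] := boolP (F \in s).
      by rewrite gt_eqF // xpos // inE.
    by rewrite x0 ?eqxx // inE.
  have xr : realization Delta x.
    split=> //.
      move=> F; have [Fs|Fs] := boolP (F \in [set:: s]%SET);
        first exact/ltW/xpos.
      by rewrite x0.
    rewrite xs inE; apply/andP; split; first by apply/fintype.subsetP=> F;
      rewrite inE => /sP.
    by apply/forall_inP=> F; rewrite inE => Fs; apply/forall_inP=> G;
      rewrite inE; apply: sch.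
  split; first by have [] := realize_gap xr.
  by apply/(flag_of_gap_supp _ fs); rewrite realize_gap_supp.
exists (barycentric w); last exact: barycentricK.
have bs F : (barycentric w F != 0) = (F \in s).
  by have := barycentric_supp sw; rewrite ws => /setP/(_ F); rewrite !inE.
split=> [F|F|].
- by rewrite inE -bs lt_neqAle barycentric_ge0 // andbT eq_sym.
- by rewrite inE -bs negbK => /eqP.
- exact: barycentric_sum.
Qed.

(** A vector on the sphere is not constant, so its flag has interior sets;
    they form the chain. A flag is determined by any vector in its weight
    class, which gives uniqueness. *)
Lemma fine_cell_chain (Z : set 'rV[R]_n) : fine_cell M Z ->
  exists! s, nonempty_chain P s /\ Z = weight_cell s.
Proof.
case=> u uB ->; have [su _] := uB; have n0 := sphere_gt0 su.
have [s us] := flag_of_exists u n0; have [fs _ _] := us.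
have us' := us; move/(flag_of_gap_supp _ fs): us' => us'.
have sP F : F \in s -> F \in P.
  move=> Fs; move/(positive_bergman_gapP su)/fintype.subsetP: uB; apply.
  by rewrite us' inE.
exists s; split.
  split; first split.
  - apply/eqP=> s0; have [a [b /gap_supp_sep[F [+ _ _]]]] := sphere_lt su.
    by rewrite us' s0 inE.
  - exact/allP.
  - exact: full_flag_sorted.
  apply/seteqP; split=> v.
    case=> vB [L [uL vL]]; split; first by case: vB.
    have [fL _ _] := uL; have [t Lt] := is_flag_full n0 fL;
      rewrite {}Lt in uL vL fL.
    by rewrite (flag_of_inj us uL).
  case=> sv vs; split; last by exists (full_flag s).
  apply/(positive_bergman_gapP sv)/fintype.subsetP=> F.
  by move/(flag_of_gap_supp _ fs): vs => ->; rewrite inE => /sP.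
move=> t [tc Zt].
have [_ ut] : weight_cell t u by rewrite -Zt; split=> //; exists (full_flag s).
exact: flag_of_inj us ut.
Qed.

End Bijection.

Theorem corollary3p5 (R : realType) (n : nat) (M : oriented_matroid n)
    (M_acyclic : acyclic (circuits M)) :
  let P := las_vergnas_proper_part M in
  let Delta := order_complex (@set_le 'I_n) P in
  exists f : {ptws {set 'I_n} -> R} -> 'rV[R]_n,
    [/\ homeomorphism_on (realization Delta) (positive_bergman M) f,
        forall s : seq {set 'I_n}, nonempty_chain P s ->
          f @` open_simplex [set:: s]%SET = weight_cell s &
        forall Z : set 'rV[R]_n, fine_cell M Z ->
          exists! s : seq {set 'I_n},
            nonempty_chain P s /\ Z = weight_cell s].
Proof.
move=> P Delta; exists (@realize R n); split.
- exact: realize_homeomorphism.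
- exact: realize_open_simplex.
- exact: fine_cell_chain.
Qed.
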